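(* Let $h$ be a formal variable and let $\mathcal{L}_\Delta(y^{[\infty]})=\sum_{k\ge 0}h^k\mathcal{L}_\Delta^{k}$ be a formal power series in $h$ whose coefficients are smooth scalar functions of the jet $y^{[\infty]}=(y,\dot y,\ddot y,\ldots)$ of a variable $y\in\mathbb{R}^n$, such that every truncation of $\mathcal{L}_\Delta$ depends only on a finite jet of $y$. Assume that the truncation to zeroth order is a regular Lagrangian $L(y,\dot y)$, i.e. the matrix $\left(\frac{\partial^2 L}{\partial \dot y^i\partial \dot y^j}\right)_{i,j}$ is invertible. For $N\in\mathbb{N}$ let $\mathcal{L}^{[N]}_\Delta$ denote the truncation of $\mathcal{L}_\Delta$ to order $\mathcal{O}(h^N)$ (i.e. $\sum_{k=0}^N h^k\mathcal{L}^k_\Delta$). Then: (1) There exists a second order modified equation $\ddot y=\sum_{k\ge0}h^k g_k(y,\dot y)$, given as a formal power series in $h$, such that for every $N\in\mathbb{N}$ any solution of the modified equation truncated to order $\mathcal{O}(h^N)$ solves the Euler–Lagrange equations of $\mathcal{L}^{[N]}_\Delta$ up to an error of order $\mathcal{O}(h^{N+1})$. (2) Writing $z=(y,\dot y)$, there exist a symplectic structure matrix $J_{\mathrm{mod}}$ and a Hamiltonian $H_{\mathrm{mod}}$, both given as formal power series in $h$ with coefficients depending on $z$, such that solutions of Hamilton's equations \[\dot z=J^{[N]}_{\mathrm{mod}}(z)^{-1}\nabla H^{[N]}_{\mathrm{mod}}(z)\] fulfil the modified equation, where $J^{[N]}_{\mathrm{mod}}$ and $H^{[N]}_{\mathrm{mod}}$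 denote the truncations of $J_{\mathrm{mod}}$ and $H_{\mathrm{mod}}$ to order $\mathcal{O}(h^N)$, for $N$ such that $\mathcal{L}^{[N]}_\Delta$ is regular, i.e. $\left(\frac{\partial^2\mathcal{L}^{[N]}_\Delta}{\partial (y^{(M)})^i\,\partial (y^{(M)})^j}\right)_{i,j}$ is invertible, where $y^{(M)}$ is the highest derivative of $y$ on which $\mathcal{L}^{[N]}_\Delta$ depends.
   Context: For a Lagrangian $\mathcal{L}(y,\dot y,\ldots,y^{(M)})$ depending on the $M$-jet of $y$, the Euler–Lagrange equations are $\sum_{j=0}^M(-1)^j\frac{\mathrm{d}^j}{\mathrm{d}t^j}\nabla_{y^{(j)}}\mathcal{L}=0$, where $\frac{\mathrm{d}}{\mathrm{d}t}$ is the total derivative on jet space. Identities between formal power series in $h$ ''up to $\mathcal{O}(h^{N+1})$'' mean equality of all coefficients of $h^k$ for $k\le N$. A symplectic structure matrix is a skew-symmetric matrix-valued function of $z$ representing a closed 2-form (as a formal power series in $h$ whose coefficients are closed 2-forms, with non-degenerate zeroth-order coefficient). *)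

(* Defs.v *)
From HB Require Import structures.
From mathcomp Require Import all_boot all_order all_algebra.
From mathcomp Require Import all_classical all_reals all_analysis.
Set Implicit Arguments. Unset Strict Implicit. Unset Printing Implicit Defensive.
Import Order.TTheory GRing.Theory Num.Theory.
Import numFieldNormedType.Exports.
Local Open Scope ring_scope.

Section ModEqDefs.
Context {R : realType}.

Fixpoint iterD {V W : normedModType R} (vs : seq V) (f : V -> W) : V -> W :=
  match vs with
  | [::] => f
  | v :: vs' => fun x => 'D_v (iterD vs' f) x
  end.

Definition smooth {V W : normedModType R} (f : V -> W) : Prop :=
  forall (vs : seq V) (x : V), differentiable (iterD vs f) x.

(** A power series in h, truncated: sum_{k=0}^N h^k c_k ; and
    "f(h) = O(h^(N+1))" in the formal sense: the Taylor coefficients of f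
    at h = 0 of order <= N vanish. *)
Definition flat_upto (N : nat) (f : R -> R) : Prop :=
  forall k, (k <= N)%N -> derive1n k f 0 = 0.

Variable n : nat.

(** Infinite jets (y, y', y'', ...) of y in R^n: Y j = y^(j). *)
Definition jet := nat -> 'rV[R]_n.

Definition depends_on (m : nat) (F : jet -> R) : Prop :=
  forall Y Z : jet, (forall j, (j < m)%N -> Y j = Z j) -> F Y = F Z.

Definition jet_of (m : nat) (A : 'M[R]_(m, n)) : jet :=
  fun j => \row_k (if (insub j : option 'I_m) is Some i then A i k else 0).

Definition jet_smooth (F : jet -> R) : Prop :=
  exists m, depends_on m F /\ smooth (fun A : 'M[R]_(m, n) => F (jet_of A)).

Definition upd (Y : jet) (j : nat) (w : 'rV[R]_n) : jet :=
  fun l => if l == j then w else Y l.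

Definition pd (j : nat) (i : 'I_n) (F : jet -> R) (Y : jet) : R :=
  derive1 (fun s : R => F (upd Y j (Y j + s *: delta_mx 0 i))) 0.

(** total derivative d/dt = sum_j y^(j+1) . grad_{y^(j)}, summed over the
    first K jet entries (exact as soon as F depends only on those). *)
Definition Dt (K : nat) (F : jet -> R) (Y : jet) : R :=
  \sum_(j < K) \sum_(i < n) pd j i F Y * Y j.+1 0 i.

(** i-th component of the Euler-Lagrange expression
    sum_{j} (-1)^j (d/dt)^j grad_{y^(j)} F  of a Lagrangian F depending only
    on the first m jet entries (y, ..., y^(m-1)); all functions involved
    depend on fewer than 2m jet entries, so Dt (2m) is the exact total
    derivative. *)
Definition EL (m : nat) (F : jet -> R) (Y : jet) (i : 'I_n) : R :=
  \sum_(j < m) (-1) ^+ j * iter j (Dt (2 * m)) (pd j i F) Y.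

Definition hess (M : nat) (F : jet -> R) (Y : jet) : 'M[R]_n :=
  \matrix_(i, j) pd M i (pd M j F) Y.

Definition Ltr (L : nat -> jet -> R) (N : nat) (h : R) : jet -> R :=
  fun Y => \sum_(k < N.+1) h ^+ k * L k Y.

Definition gtr (g : nat -> 'rV[R]_(n + n) -> 'rV[R]_n) (N : nat) (h : R)
  : 'rV[R]_(n + n) -> 'rV[R]_n :=
  fun z => \sum_(k < N.+1) h ^+ k *: g k z.

(** Prolongation: for solutions of y'' = F(y, y'), y^(j) = prol F j (y, y'). *)
Fixpoint prol (F : 'rV[R]_(n + n) -> 'rV[R]_n) (j : nat)
  : 'rV[R]_(n + n) -> 'rV[R]_n :=
  match j with
  | 0 => fun z => lsubmx z
  | j'.+1 => fun z => 'D_(row_mx (rsubmx z) (F z)) (prol F j') z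
  end.

Definition grad (phi : 'rV[R]_(n + n) -> R) (z : 'rV[R]_(n + n))
  : 'rV[R]_(n + n) :=
  \row_a 'D_(delta_mx 0 a) phi z.

(** J represents a closed 2-form: d(sum J_ab dz^a /\ dz^b) = 0 *)
Definition closed_form (J : 'rV[R]_(n + n) -> 'M[R]_(n + n)) : Prop :=
  forall z a b c,
    'D_(delta_mx 0 a) (fun w => J w b c) z
  + 'D_(delta_mx 0 b) (fun w => J w c a) z
  + 'D_(delta_mx 0 c) (fun w => J w a b) z = 0.

Definition sympl_struct (J : nat -> 'rV[R]_(n + n) -> 'M[R]_(n + n)) : Prop :=
  [/\ forall k, smooth (J k),
      forall k z, (J k z)^T = - J k z,
      forall k, closed_form (J k)
    & forall z, J 0 z \in unitmx].

Definition Jtr (J : nat -> 'rV[R]_(n + n) -> 'M[R]_(n + n)) (N : nat) (h : R)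
  (z : 'rV[R]_(n + n)) : 'M[R]_(n + n) :=
  \sum_(k < N.+1) h ^+ k *: J k z.

Definition Htr (H : nat -> 'rV[R]_(n + n) -> R) (N : nat) (h : R)
  (z : 'rV[R]_(n + n)) : R :=
  \sum_(k < N.+1) h ^+ k * H k z.

Definition hamvf (J : nat -> 'rV[R]_(n + n) -> 'M[R]_(n + n))
  (H : nat -> 'rV[R]_(n + n) -> R) (N : nat) (h : R) (z : 'rV[R]_(n + n))
  : 'rV[R]_(n + n) :=
  (invmx (Jtr J N h z) *m (grad (Htr H N h) z)^T)^T.

Definition regular_trunc (L : nat -> jet -> R) (N : nat) : Prop :=
  exists M : nat,
    (forall h, depends_on M.+1 (Ltr L N h)) /\
    (forall Y : jet, \forall h \near dnbhs (0 : R), hess M (Ltr L N h) Y \in unitmx).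

End ModEqDefs.

(* Main.v *)
(* On U = R x R^(2n), with points (h, z), replace formal power series in h by
   smooth functions modulo h^k. Since mixed partial derivatives commute, this
   congruence is stable under sums, products, composition with smooth functions
   and differentiation in z.

   (1) The Euler-Lagrange expression restricted to the flow of y'' = G is
   force - G * A + sum_(k >= 1) h^k E_k[G], with A the invertible Hessian of the
   zeroth order Lagrangian. Solving for G gives a fixed point equation whose
   right-hand side gains one power of h on every congruence, so that its
   iteration determines the coefficients g_k one after the other.

   (2) With the Ostrogradsky momenta p_j pulled back to the flow, the first
   variation formula reads dL = L_X theta + EL . dy for theta = sum_j p_j dy^(j),
   hence i_X d(theta) = - d(H) + EL . dy with H = sum_j p_j y^(j+1) - L. The
   last term vanishes in the congruence, so J and H are read off the
   coefficients of d(theta) and H. At h = 0 the form d(theta) is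
   d(dL/dy') /\ dy, nondegenerate because A is invertible. *)
Require Import Defs.
From HB Require Import structures.
From mathcomp Require Import all_boot all_order all_algebra.
From mathcomp Require Import all_classical all_reals all_analysis.
From mathcomp Require Import ring.
Import Order.TTheory GRing.Theory Num.Theory.
Import numFieldNormedType.Exports.
Set Implicit Arguments. Unset Strict Implicit. Unset Printing Implicit Defensive.
Local Open Scope ring_scope.

(** * Smooth functions *)

Section SmoothCalculus.
Context {R : realType}.
Implicit Types V W : normedModType R.

(** Composing a smooth Lagrangian with a formal series would need a Taylor expansion in all jet
    variables; for genuine functions of [(h, z)] it is the chain rule. The price is that the series
    in [h] need not converge, so no single function serves all orders: each [N] has its own smooth
    approximation, and the coefficient of [h^k] is a Taylor coefficient of the [k]-th one, which
    later ones leave unchanged.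

    The number of jet entries in [L k] may grow with [k]. Momenta, one-forms and energies are
    therefore built for each [L k] separately, along one common flow, and then summed with weights
    [h^k].

    The inverse of the truncated [J] need not be smooth on all of [(h, z)]: the determinant is
    nonzero at [h = 0] but may vanish at a distance from it that depends on [z]. Division by it is
    postponed to the end and carried out for fixed [z], on germs in [h]. *)

Fixpoint Cn {V W} (k : nat) (f : V -> W) : Prop :=
  match k with
  | 0 => forall x, differentiable f x
  | k'.+1 => (forall x, differentiable f x) /\ forall v, Cn k' ('D_v f)
  end.

Lemma CnW V W k (f : V -> W) : Cn k.+1 f -> Cn k f.
Proof.
elim: k f => [|k IH] f; first by case.
by case=> df H; split=> // v; apply: IH; apply: H.
Qed.

Lemma iterD_rcons V W vs (v : V) (f : V -> W) :
  Defs.iterD (rcons vs v) f = Defs.iterD vs ('D_v f).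
Proof. by elim: vs => //= w vs ->. Qed.

(** Closure properties are proved by induction on the level [k]: the derivative of a product or
    composite has the same shape one level down, whereas [iterD] would call for an expanded Leibniz
    formula. [iterD] applies the last direction of the list first, hence the induction from the
    right. *)
Lemma smoothE V W (f : V -> W) : smooth f <-> forall k, Cn k f.
Proof.
split=> [sf k|Hf vs].
  elim: k f sf => [|k IH] f sf; first exact: (sf [::]).
  split; first exact: (sf [::]).
  by move=> v; apply: IH => vs x; rewrite -iterD_rcons; apply: sf.
elim/last_ind: vs f Hf => [|vs v IH] f Hf; first exact: (Hf 0%N).
by move=> x; rewrite iterD_rcons; apply: IH => k; have [_] := Hf k.+1; apply.
Qed.

Lemma smooth_Cn V W k (f : V -> W) : smooth f -> Cn k f.
Proof. by move=> /smoothE. Qed.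

Lemma smooth_differentiable V W (f : V -> W) : smooth f -> forall x, differentiable f x.
Proof. by move=> sf; exact: (sf [::]). Qed.

Lemma smooth_derivable V W (f : V -> W) : smooth f -> forall x v, derivable f x v.
Proof. by move=> sf x v; apply: diff_derivable; exact: smooth_differentiable. Qed.

Lemma smooth_derive V W (f : V -> W) v : smooth f -> smooth ('D_v f).
Proof. by move=> sf vs x; rewrite -iterD_rcons; apply: sf. Qed.

Lemma smooth_intro V W (f : V -> W) :
  (forall x, differentiable f x) -> (forall v, smooth ('D_v f)) -> smooth f.
Proof.
by move=> df sD; apply/smoothE => -[|k] //; split=> // v; exact: smooth_Cn.
Qed.

Lemma Cn_cst V W k (c : W) : Cn k (fun _ : V => c).
Proof.
elim: k c => [|k IH] c; first by move=> x; exact: differentiable_cst.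
split=> [x|v]; first exact: differentiable_cst.
rewrite [X in Cn _ X](_ : _ = fun _ => 0) //.
by apply/funext => x; exact: derive_cst.
Qed.

Lemma smooth_cst V W (c : W) : smooth (fun _ : V => c).
Proof. by apply/smoothE => k; exact: Cn_cst. Qed.

Lemma CnD V W k (f g : V -> W) : Cn k f -> Cn k g -> Cn k (fun x => f x + g x).
Proof.
elim: k f g => [|k IH] f g; first by move=> df dg x; exact: differentiableD.
move=> [df Df] [dg Dg]; split=> [x|v]; first exact: differentiableD.
rewrite [X in Cn _ X](_ : _ = fun x => 'D_v f x + 'D_v g x).
  by apply: IH; [exact: Df|exact: Dg].
by apply/funext => x; apply: deriveD; exact: diff_derivable.
Qed.

Lemma smoothD V W (f g : V -> W) : smooth f -> smooth g -> smooth (fun x => f x + g x).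
Proof. by move=> sf sg; apply/smoothE => k; apply: CnD; exact: smooth_Cn. Qed.

Lemma CnM V k (f g : V -> R) : Cn k f -> Cn k g -> Cn k (fun x => f x * g x).
Proof.
elim: k f g => [|k IH] f g; first by move=> df dg x; exact: differentiableM.
move=> Cf Cg; have [df Df] := Cf; have [dg Dg] := Cg.
split=> [x|v]; first exact: differentiableM.
rewrite [X in Cn _ X](_ : _ = fun x => f x * 'D_v g x + g x * 'D_v f x).
  by apply: CnD; apply: IH; first [exact: CnW|exact: Df|exact: Dg].
by apply/funext => x; apply: deriveM; exact: diff_derivable.
Qed.

Lemma smoothM V (f g : V -> R) : smooth f -> smooth g -> smooth (fun x => f x * g x).
Proof. by move=> sf sg; apply/smoothE => k; apply: CnM; exact: smooth_Cn. Qed.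

Lemma smoothZ V (c : R) (f : V -> R) : smooth f -> smooth (fun x => c * f x).
Proof. by apply: smoothM; exact: smooth_cst. Qed.

Lemma smoothN V (f : V -> R) : smooth f -> smooth (fun x => - f x).
Proof.
move=> sf; rewrite (_ : (fun _ => _) = fun x => -1 * f x); first exact: smoothZ.
by apply/funext => x; rewrite mulN1r.
Qed.

Lemma smoothB V (f g : V -> R) : smooth f -> smooth g -> smooth (fun x => f x - g x).
Proof. by move=> sf sg; apply: smoothD => //; exact: smoothN. Qed.

Lemma smoothX V (f : V -> R) k : smooth f -> smooth (fun x => f x ^+ k).
Proof.
move=> sf; elim: k => [|k IH]; first exact: smooth_cst.
by under eq_fun do rewrite exprS; exact: smoothM.
Qed.

Lemma Cn_sum V W k (I : Type) (r : seq I) (P : pred I) (f : I -> V -> W) :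
  (forall i, P i -> Cn k (f i)) -> Cn k (fun x => \sum_(i <- r | P i) f i x).
Proof.
move=> Cf; elim: r => [|i r IH].
  by under eq_fun do rewrite big_nil; exact: Cn_cst.
under eq_fun do rewrite big_cons.
by case: (boolP (P i)) => // Pi; apply: CnD => //; exact: Cf.
Qed.

Lemma smooth_sum V W (I : Type) (r : seq I) (P : pred I) (f : I -> V -> W) :
  (forall i, P i -> smooth (f i)) -> smooth (fun x => \sum_(i <- r | P i) f i x).
Proof.
by move=> sf; apply/smoothE => k; apply: Cn_sum => i /sf; exact: smooth_Cn.
Qed.

Lemma smooth_prod V (I : Type) (r : seq I) (P : pred I) (f : I -> V -> R) :
  (forall i, P i -> smooth (f i)) -> smooth (fun x => \prod_(i <- r | P i) f i x).
Proof.
move=> sf; elim: r => [|i r IH].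
  by under eq_fun do rewrite big_nil; exact: smooth_cst.
under eq_fun do rewrite big_cons.
by case: (boolP (P i)) => // Pi; apply: smoothM => //; exact: sf.
Qed.

Lemma derive_sumE V W (I : Type) (r : seq I) (f : I -> V -> W) v x :
  (forall i, smooth (f i)) ->
  'D_v (fun x => \sum_(i <- r) f i x) x = \sum_(i <- r) 'D_v (f i) x.
Proof.
move=> sf; elim: r => [|i r IH].
  rewrite (_ : (fun x => \sum_(i <- [::]) f i x) = cst 0); last first.
    by apply/funext => y; rewrite big_nil.
  by rewrite big_nil; exact: derive_cst.
rewrite (_ : (fun x => \sum_(i <- i :: r) f i x) = f i + fun x => \sum_(i <- r) f i x); last first.
  by apply/funext => y; rewrite big_cons.
rewrite big_cons -IH deriveD //; first exact: smooth_derivable.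
by apply: smooth_derivable; apply: smooth_sum.
Qed.

Lemma deriveME V (f g : V -> R) v x : smooth f -> smooth g ->
  'D_v (fun x => f x * g x) x = 'D_v f x * g x + f x * 'D_v g x.
Proof.
move=> sf sg.
transitivity (f x * 'D_v g x + g x * 'D_v f x).
  by apply: deriveM; exact: smooth_derivable.
by rewrite addrC [X in X + _]mulrC.
Qed.

Lemma deriveBE V (f g : V -> R) v x : smooth f -> smooth g ->
  'D_v (fun x => f x - g x) x = 'D_v f x - 'D_v g x.
Proof. by move=> sf sg; apply: deriveB; exact: smooth_derivable. Qed.

Lemma deriveDE V W (f g : V -> W) v x : smooth f -> smooth g ->
  'D_v (fun x => f x + g x) x = 'D_v f x + 'D_v g x.
Proof. by move=> sf sg; apply: deriveD; exact: smooth_derivable. Qed.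

Lemma deriveZE V (c : R) (f : V -> R) v x : smooth f ->
  'D_v (fun x => c * f x) x = c * 'D_v f x.
Proof. by move=> sf; apply: deriveZ; exact: smooth_derivable. Qed.

Lemma derive_comp_affine V V' W (f : V -> W) (l : V' -> V) (c : V) v x :
  linear l ->
  'D_v (fun y => f (l y + c)) x = 'D_(l v) f (l x + c).
Proof.
move=> ll; suff E : (fun h : R => h^-1 *: (((fun y => f (l y + c)) \o shift x) (h *: v)
    - f (l x + c))) =
  (fun h : R => h^-1 *: ((f \o shift (l x + c)) (h *: l v) - f (l x + c))).
  by rewrite /derive E.
by apply/funext => h /=; rewrite ll addrA.
Qed.

Lemma Cn_comp_affine V V' W k (f : V -> W) (l : {linear V' -> V}) (c : V) :
  continuous l -> Cn k f -> Cn k (fun y => f (l y + c)).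
Proof.
move=> cl; have dl x : differentiable (fun y => l y + c) x.
  by apply: differentiableD; [exact: linear_differentiable|exact: differentiable_cst].
elim: k f => [|k IH] f.
  by move=> df x; exact: (differentiable_comp (dl x) (df _)).
move=> [df Df]; split=> [x|v].
  exact: (differentiable_comp (dl x) (df _)).
rewrite [X in Cn _ X](_ : _ = fun y => 'D_(l v) f (l y + c)).
  by apply: (IH ('D_(l v) f)); exact: Df.
by apply/funext => x; apply: derive_comp_affine; exact: linearP.
Qed.

Lemma smooth_comp_affine V V' W (f : V -> W) (l : {linear V' -> V}) (c : V) :
  continuous l -> smooth f -> smooth (fun y => f (l y + c)).
Proof. by move=> cl sf; apply/smoothE => k; apply: Cn_comp_affine => //; exact: smooth_Cn. Qed.

Lemma smooth_linear V W (l : {linear V -> W}) : continuous l -> smooth l.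
Proof.
move=> cl; apply: smooth_intro => [x|v]; first exact: linear_differentiable.
rewrite (_ : 'D_v l = fun=> l v); first exact: smooth_cst.
apply/funext => x; rewrite deriveE; last exact: linear_differentiable.
by rewrite diff_lin.
Qed.

Lemma derive_linear V W (l : {linear V -> W}) v x : continuous l -> 'D_v l x = l v.
Proof. by move=> cl; rewrite deriveE ?diff_lin //; exact: linear_differentiable. Qed.

Lemma smooth_comp_snd V V' (f : V' -> R) : smooth f -> smooth (fun u : V * V' => f u.2).
Proof.
move=> sf; under eq_fun do rewrite -[_.2]addr0.
by apply: (@smooth_comp_affine V' (V * V')%type _ f snd) => // x; exact: cvg_snd.
Qed.

(** * Functions of matrices and matrix-valued functions *)

Lemma coord_linear p q (i : 'I_p) (j : 'I_q) : linear (fun A : 'M[R]_(p, q) => A i j).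
Proof. by move=> c A B; rewrite !mxE. Qed.

Lemma smooth_coord p q (i : 'I_p) (j : 'I_q) : smooth (fun A : 'M[R]_(p, q) => A i j).
Proof.
pose lM := GRing.isLinear.Build _ _ _ _ _ (@coord_linear p q i j).
pose l : {linear 'M[R]_(p, q) -> R} := HB.pack (fun A : 'M[R]_(p, q) => A i j) lM.
apply: (@smooth_linear _ _ l); exact: coord_continuous.
Qed.

Lemma derive_coord p q (i : 'I_p) (j : 'I_q) v x :
  'D_v (fun A : 'M[R]_(p, q) => A i j) x = v i j.
Proof.
pose lM := GRing.isLinear.Build _ _ _ _ _ (@coord_linear p q i j).
pose l : {linear 'M[R]_(p, q) -> R} := HB.pack (fun A : 'M[R]_(p, q) => A i j) lM.
apply: (@derive_linear _ _ l); exact: coord_continuous.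
Qed.

Lemma differentiable_mx V p q (A : 'I_p -> 'I_q -> V -> R) x :
  (forall i j, differentiable (A i j) x) ->
  differentiable (fun u => \matrix_(i, j) A i j u) x.
Proof.
move=> dA; rewrite (_ : (fun _ => _) =
  \sum_(i < p) \sum_(j < q) fun u => A i j u *: (delta_mx i j : 'M[R]_(p, q))).
  apply: differentiable_sum => i; apply: differentiable_sum => j.
  exact: differentiableZl.
apply/funext => u; rewrite fct_sumE [LHS]matrix_sum_delta.
apply: eq_bigr => i _; rewrite fct_sumE; apply: eq_bigr => j _.
by rewrite mxE.
Qed.

Lemma derive_mxE V p q (A : 'I_p -> 'I_q -> V -> R) v x :
  (forall i j, differentiable (A i j) x) ->
  'D_v (fun u => \matrix_(i, j) A i j u) x = \matrix_(i, j) 'D_v (A i j) x.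
Proof.
move=> dA; rewrite derive_mx; last by apply: diff_derivable; exact: differentiable_mx.
apply/matrixP => i j; rewrite mxE [RHS]mxE.
by rewrite (_ : (fun t => _) = A i j) //; apply/funext => t; rewrite mxE.
Qed.

Lemma smooth_mx V p q (A : 'I_p -> 'I_q -> V -> R) :
  (forall i j, smooth (A i j)) -> smooth (fun u => \matrix_(i, j) A i j u).
Proof.
move=> sA; apply/smoothE => k; have {sA} : forall i j, Cn k (A i j).
  by move=> i j; exact: smooth_Cn.
elim: k A => [|k IH] A CA; first by move=> x; apply: differentiable_mx => i j; exact: CA.
split=> [x|v]; first by apply: differentiable_mx => i j; have [] := CA i j.
rewrite [X in Cn _ X](_ : _ = fun u => \matrix_(i, j) 'D_v (A i j) u).
  by apply: IH => i j; have [_ H] := CA i j; exact: H.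
by apply/funext => x; apply: derive_mxE => i j; have [] := CA i j.
Qed.

(** The chain rule in coordinates. Matrices stand for truncated jets below, so the double sum
    becomes one over derivative orders and components. *)
Lemma derive_comp_mx V p q (f : 'M[R]_(p, q) -> R) (A : 'I_p -> 'I_q -> V -> R) v x :
  (forall i j, differentiable (A i j) x) ->
  differentiable f (\matrix_(i, j) A i j x) ->
  'D_v (fun u => f (\matrix_(i, j) A i j u)) x =
  \sum_i \sum_j 'D_(delta_mx i j) f (\matrix_(i, j) A i j x) * 'D_v (A i j) x.
Proof.
move=> dA df; pose B u := \matrix_(i, j) A i j u.
have dB : differentiable B x by exact: differentiable_mx.
rewrite -[fun u => _]/(f \o B) deriveE; last exact: differentiable_comp.
rewrite diff_comp //= -(deriveE _ dB) derive_mxE // [X in 'd _ _ X]matrix_sum_delta.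
rewrite linear_sum; apply: eq_bigr => i _; rewrite linear_sum; apply: eq_bigr => j _.
by rewrite linearZ /= mxE mulrC -deriveE.
Qed.

(** The chain rule yields products of composites of the same kind with derivatives of the entries,
    one level lower; hence the induction over all [f] and [A]. *)
Lemma smooth_comp_mx V p q (f : 'M[R]_(p, q) -> R) (A : 'I_p -> 'I_q -> V -> R) :
  smooth f -> (forall i j, smooth (A i j)) ->
  smooth (fun u => f (\matrix_(i, j) A i j u)).
Proof.
move=> sf sA; apply/smoothE => k; have {sf} : Cn k f by exact: smooth_Cn.
have {sA} : forall i j, Cn k (A i j) by move=> i j; exact: smooth_Cn.
elim: k f A => [|k IH] f A CA Cf.
  move=> x; apply: (@differentiable_comp _ _ _ _ (fun u => \matrix_(i, j) A i j u) f).
    by apply: differentiable_mx => i j; exact: CA.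
  exact: Cf.
have dA i j x : differentiable (A i j) x by have [] := CA i j.
have [df Df] := Cf.
split=> [x|v].
  apply: (@differentiable_comp _ _ _ _ (fun u => \matrix_(i, j) A i j u) f) => //.
  exact: differentiable_mx.
rewrite [X in Cn _ X](_ : _ = fun x => \sum_i \sum_j
  'D_(delta_mx i j) f (\matrix_(i, j) A i j x) * 'D_v (A i j) x).
  apply: Cn_sum => i _; apply: Cn_sum => j _; apply: CnM.
    by apply: (IH ('D_(delta_mx i j) f)) => [a b|]; [exact: CnW|exact: Df].
  by have [_ H] := CA i j; exact: H.
by apply/funext => x; exact: derive_comp_mx.
Qed.

Lemma smoothV V (f : V -> R) : (forall x, f x != 0) -> smooth f ->
  smooth (fun x => (f x)^-1).
Proof.
move=> f0 sf; apply/smoothE => k; have {sf} : Cn k.+1 f by exact: smooth_Cn.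
elim: k => [|k IH] Cf; first by move=> x; apply: differentiableV => //; case: Cf.
have [df Df] := Cf.
split=> [x|v]; first by apply: differentiableV.
rewrite [X in Cn _ X](_ : _ = fun x => -1 * ((f x)^-1 * (f x)^-1 * 'D_v f x)).
  (* The derivative of [1/f] contains [1/f] itself, supplied one level down. *)
  have CV := IH (CnW Cf).
  apply: CnM; first exact: Cn_cst.
  by apply: CnM; [exact: CnM|apply: CnW; exact: Df].
apply/funext => x; rewrite [LHS]deriveV //; last exact: diff_derivable.
by rewrite /GRing.scale /= mulN1r expr2 invfM mulNr.
Qed.

Lemma smooth_det V p (A : V -> 'M[R]_p) :
  (forall i j, smooth (fun u => A u i j)) -> smooth (fun u => \det (A u)).
Proof.
move=> sA; apply: smooth_sum => s _; apply: smoothZ; apply: smooth_prod => i _.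
exact: sA.
Qed.

Lemma smooth_adj V p (A : V -> 'M[R]_p) i j :
  (forall i j, smooth (fun u => A u i j)) -> smooth (fun u => (\adj (A u)) i j).
Proof.
move=> sA; under eq_fun do rewrite mxE /cofactor.
apply: smoothZ; apply: smooth_det => a b.
by under eq_fun do rewrite !mxE; exact: sA.
Qed.

Lemma smooth_invmx V p (A : V -> 'M[R]_p) i j :
  (forall u, A u \in unitmx) ->
  (forall i j, smooth (fun u => A u i j)) -> smooth (fun u => (invmx (A u)) i j).
Proof.
move=> uA sA; under eq_fun do rewrite /invmx uA mxE.
apply: smoothM; last exact: smooth_adj.
by apply: smoothV; [move=> u; have := uA u; rewrite unitmxE unitfE|exact: smooth_det].
Qed.

End SmoothCalculus.

(** * Symmetry of second derivatives *)

Section Schwarz.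
Local Open Scope classical_set_scope.
Local Open Scope ring_scope.
Context {R : realType} {V : normedModType R}.
Implicit Types (f : V -> R) (v w x : V).

Lemma smooth_shift f c : smooth f -> smooth (fun y => f (y + c)).
Proof.
by move=> sf; apply: (@smooth_comp_affine _ _ _ _ f idfun) => // x; exact: cvg_id.
Qed.

Lemma derive_shiftE f c v x : 'D_v (fun y => f (y + c)) x = 'D_v f (x + c).
Proof. exact: (@derive_comp_affine _ _ _ _ f idfun). Qed.

Lemma scalel_linear v : linear (fun s : R => s *: v).
Proof. by move=> a s t; rewrite scalerDl -scalerA. Qed.

Lemma smooth_line f v x : smooth f -> smooth (fun s : R => f (s *: v + x)).
Proof.
move=> sf.
pose lM := GRing.isLinear.Build _ _ _ _ _ (scalel_linear v).
pose l : {linear R -> V} := HB.pack (fun s : R => s *: v) lM.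
apply: (@smooth_comp_affine _ _ _ _ f l) => //; exact: scalel_continuous.
Qed.

Lemma derive_line f v x (s : R) : 'D_1 (fun s : R => f (s *: v + x)) s = 'D_v f (s *: v + x).
Proof.
by rewrite (@derive_comp_affine _ _ _ _ f (fun s : R => s *: v)) ?scale1r //; exact: scalel_linear.
Qed.

Lemma line_MVT f v x (t : R) : smooth f -> 0 < t ->
  exists2 c, 0 < c < t & f (t *: v + x) - f x = 'D_v f (c *: v + x) * t.
Proof.
move=> sf t0; have sl := smooth_line v x sf.
have [||c c0t E] := @MVT R (fun s => f (s *: v + x)) (fun s => 'D_v f (s *: v + x)) 0 t t0.
- by move=> s _; apply: DeriveDef; [exact: smooth_derivable|exact: derive_line].
- apply: continuous_subspaceT => s; apply: differentiable_continuous.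
  exact: smooth_differentiable.
by exists c; rewrite ?in_itv // in c0t *; rewrite scale0r add0r subr0 in E.
Qed.

(** Two applications of the mean value theorem: along [v] to the increment of [f] by [t *: w], then
    along [w] to ['D_v f]. *)
Lemma second_difference f v w x (t : R) : smooth f -> 0 < t ->
  exists s r, [/\ 0 < s < t, 0 < r < t &
   (f (t *: v + x + t *: w) - f (t *: v + x)) - (f (x + t *: w) - f x)
   = 'D_w ('D_v f) (r *: w + (s *: v + x)) * t * t].
Proof.
move=> sf t0.
have sF : smooth (fun y => f (y + t *: w) - f y).
  by apply: smoothB => //; exact: smooth_shift.
have [s s0t ->] := line_MVT v x sF t0.
have [r r0t E] := line_MVT w (s *: v + x) (smooth_derive v sf) t0.
exists s, r; split=> //; congr (_ * _); rewrite -E.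
rewrite deriveBE //; last exact: smooth_shift.
by rewrite derive_shiftE addrC [t *: w + _]addrC addrC.
Qed.

Lemma continuous_plane f v w x : {for x, continuous f} ->
  forall e, 0 < e -> exists2 d, 0 < d & forall s r : R, 0 < s < d -> 0 < r < d ->
    `|f x - f (r *: w + (s *: v + x))| < e.
Proof.
move=> cf e e0.
have : (fun p : R * R => f (p.2 *: w + (p.1 *: v + x))) @ (0 : R * R)%type --> f x.
  have cg : (fun p : R * R => p.2 *: w + (p.1 *: v + x)) @ (0 : R * R)%type --> x.
    have {2}<- : 0 *: w + (0 *: v + x) = x by rewrite !scale0r !add0r.
    apply: cvgD; first by apply: cvgZr_tmp; exact: cvg_snd.
    by apply: cvgD; [apply: cvgZr_tmp; exact: cvg_fst|exact: cvg_cst].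
  apply: (cvg_trans (cvg_app f cg)); exact: cf.
move/cvgrPdist_lt => /(_ e e0) /nbhs_ballP [d /= d0 H].
exists d => // s r /andP[s0 sd] /andP[r0 rd]; apply: (H (s, r)).
by split; rewrite /= -ball_normE /= sub0r normrN gtr0_norm.
Qed.

Lemma dist_via (a b c c' e : R) :
  c = c' -> `|a - c'| < e / 2 -> `|b - c| < e / 2 -> `|a - b| <= e.
Proof.
move=> <- hac hbc; rewrite (splitr e) -(subrKA c) (le_trans (ler_normD _ _)) //.
by rewrite lerD // ltW // distrC.
Qed.

(** The second difference over the parallelogram of [t *: v] and [t *: w] is symmetric in [v] and
    [w]. Evaluated in both orders, it shows that the two mixed derivatives, at two points near [x],
    are equal; continuity then bounds their difference at [x] by any [e > 0]. *)
Lemma derive_comm f v w x : smooth f -> 'D_v ('D_w f) x = 'D_w ('D_v f) x.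
Proof.
move=> sf.
have c1 : {for x, continuous ('D_w ('D_v f))}.
  by apply: differentiable_continuous; apply: smooth_differentiable; do 2 apply: smooth_derive.
have c2 : {for x, continuous ('D_v ('D_w f))}.
  by apply: differentiable_continuous; apply: smooth_differentiable; do 2 apply: smooth_derive.
apply/eqP; rewrite -subr_eq0 -normr_eq0; apply/eqP/le_anti; rewrite normr_ge0 andbT.
apply/ler_addgt0Pl => e e0; rewrite addr0.
have e20 : 0 < e / 2 by rewrite divr_gt0.
have [d1 d10 H1] := continuous_plane v w c1 e20.
have [d2 d20 H2] := continuous_plane w v c2 e20.
pose t := Num.min d1 d2 / 2.
have m0 : 0 < Num.min d1 d2 by rewrite lt_min d10.
have t0 : 0 < t by rewrite divr_gt0.
have [td1 td2] : t < d1 /\ t < d2.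
  by apply/andP; rewrite -lt_min /t ltr_pdivrMr // ltr_pMr // ltr1n.
have [s [r [/andP[s0 st] /andP[r0 rt] E1]]] := second_difference v w x sf t0.
have [s' [r' [/andP[s0' st'] /andP[r0' rt'] E2]]] := second_difference w v x sf t0.
have E : 'D_w ('D_v f) (r *: w + (s *: v + x)) = 'D_v ('D_w f) (r' *: v + (s' *: w + x)).
  suff E3 : 'D_w ('D_v f) (r *: w + (s *: v + x)) * t * t =
            'D_v ('D_w f) (r' *: v + (s' *: w + x)) * t * t.
    by move: E3 => /(mulIf (lt0r_neq0 t0)) /(mulIf (lt0r_neq0 t0)).
  have et : t *: w + x + t *: v = t *: v + x + t *: w by rewrite [LHS]addrC addrCA [LHS]addrC.
  have swap (a b c d : R) : a - b - (c - d) = a - c - (b - d) by ring.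
  apply: etrans (esym E1) _; apply: etrans _ E2.
  by rewrite et [x + t *: v]addrC [x + t *: w]addrC; exact: swap.
have lt0d (u : R) d : t < d -> 0 < u -> u < t -> 0 < u < d.
  by move=> td u0 ut; rewrite u0 (lt_trans ut td).
have h1 := H1 s r (lt0d _ _ td1 s0 st) (lt0d _ _ td1 r0 rt).
have h2 := H2 s' r' (lt0d _ _ td2 s0' st') (lt0d _ _ td2 r0' rt').
exact: (dist_via E h2 h1).
Qed.

End Schwarz.

(** * Congruence modulo powers of h *)

Section HAdic.
Context {R : realType} {V : normedModType R}.
Notation U := (R * V)%type.
Implicit Types (f g : U -> R) (v z : V).

Definition dh f : U -> R := 'D_((1, 0) : U) f.
Definition dz v f : U -> R := 'D_((0, v) : U) f.

Lemma smooth_dh f : smooth f -> smooth (dh f).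
Proof. exact: smooth_derive. Qed.

Lemma smooth_dz v f : smooth f -> smooth (dz v f).
Proof. exact: smooth_derive. Qed.

Lemma smooth_iter_dh k f : smooth f -> smooth (iter k dh f).
Proof. by move=> sf; elim: k => //= k; exact: smooth_dh. Qed.

Lemma dh_dz v f : smooth f -> dh (dz v f) = dz v (dh f).
Proof. by move=> sf; apply/funext => u; exact: derive_comm. Qed.

Lemma dz_dz v w f : smooth f -> dz v (dz w f) = dz w (dz v f).
Proof. by move=> sf; apply/funext => u; exact: derive_comm. Qed.

Lemma dhE f (h : R) z : dh f (h, z) = derive1 (fun h => f (h, z)) h.
Proof.
suff E : (fun s : R => s^-1 *: ((f \o shift (h, z)) (s *: ((1, 0) : U)) - f (h, z))) =
         (fun s : R => s^-1 *: (((fun h => f (h, z)) \o shift h) (s *: 1) - f (h, z))).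
  by rewrite derive1E /dh /derive E.
by apply/funext => s /=; congr (_ *: (f _ - _)); congr pair; rewrite /= ?scaler0 ?add0r.
Qed.

Lemma dzE v f (h : R) z : dz v f (h, z) = 'D_v (fun z => f (h, z)) z.
Proof.
suff E : (fun s : R => s^-1 *: ((f \o shift (h, z)) (s *: ((0, v) : U)) - f (h, z))) =
         (fun s : R => s^-1 *: (((fun z => f (h, z)) \o shift z) (s *: v) - f (h, z))).
  by rewrite /dz /derive E.
by apply/funext => s /=; congr (_ *: (f _ - _)); congr pair; rewrite /= ?scaler0 ?add0r.
Qed.

Lemma derive1n_section k f (h : R) z :
  derive1n k (fun h => f (h, z)) h = iter k dh f (h, z).
Proof.
elim: k h => [//|k IH] h; rewrite derive1nS iterS dhE; congr derive1.
by apply/funext => t; exact: IH.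
Qed.

Lemma smooth_section (h : R) f : smooth f -> smooth (fun z => f (h, z)).
Proof.
move=> sf; have E f' : (fun z => f' (h, z)) = (fun z => f' ((0, z) + (h, 0))) :> (V -> R).
  by apply/funext => z; congr f'; congr pair; rewrite /= ?add0r ?addr0.
have d z : differentiable (fun z : V => ((0, z) : U) + (h, 0)) z.
  apply: differentiableD; last exact: differentiable_cst.
  by apply: differentiable_pair; [exact: differentiable_cst|exact: ex_diff].
apply/smoothE => k; elim: k f sf => [|k IH] f sf.
  move=> z; rewrite E; apply: (differentiable_comp (d z)); exact: smooth_differentiable.
split=> [z|v].
  rewrite E; apply: (differentiable_comp (d z)); exact: smooth_differentiable.
rewrite [X in Cn _ X](_ : _ = fun z => dz v f (h, z)).
  by apply: IH; exact: smooth_dz.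
by apply/funext => z; rewrite dzE.
Qed.

Lemma smooth_h : smooth (fun u : U => u.1).
Proof. by apply: (@smooth_linear _ U R^o fst) => // x; exact: cvg_fst. Qed.

Lemma dh_h u : dh (fun u => u.1) u = 1.
Proof. by apply: (@derive_linear _ U R^o fst) => // x; exact: cvg_fst. Qed.

(* Congruence modulo [h^k] of smooth functions of [(h, z)]. *)
Fixpoint eqh (k : nat) f g : Prop :=
  if k is k'.+1 then (forall z, f (0, z) = g (0, z)) /\ eqh k' (dh f) (dh g)
  else True.

(** The recursive form suits inductions through the Leibniz and chain rules; this one makes the
    equivalence laws and monotonicity in [k] immediate. *)
Lemma eqhP k f g : eqh k f g <->
  forall j, (j < k)%N -> forall z, iter j dh f (0, z) = iter j dh g (0, z).
Proof.
elim: k f g => [|k IH] f g; first by split.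
split=> [[e0 /IH e] [|j] // jk z|e].
  by rewrite !iterSr e.
split; first exact: (e 0%N).
by apply/IH => j jk z; have := e j.+1 jk z; rewrite !iterSr.
Qed.

Lemma eqh_refl k f : eqh k f f.
Proof. exact/eqhP. Qed.

Lemma eqh_sym k f g : eqh k f g -> eqh k g f.
Proof. by move=> /eqhP e; apply/eqhP => j jk z; rewrite e. Qed.

Lemma eqh_trans k g f f' : eqh k f g -> eqh k g f' -> eqh k f f'.
Proof. by move=> /eqhP e /eqhP e'; apply/eqhP => j jk z; rewrite e // e'. Qed.

Lemma eqh_le k k' f g : (k' <= k)%N -> eqh k f g -> eqh k' f g.
Proof.
by move=> kk' /eqhP e; apply/eqhP => j jk z; rewrite e // (leq_trans jk).
Qed.

Lemma dhD f g : smooth f -> smooth g -> dh (fun u => f u + g u) = fun u => dh f u + dh g u.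
Proof. by move=> sf sg; apply/funext => u; exact: deriveDE. Qed.

Lemma dhM f g : smooth f -> smooth g ->
  dh (fun u => f u * g u) = fun u => dh f u * g u + f u * dh g u.
Proof. by move=> sf sg; apply/funext => u; exact: deriveME. Qed.

Lemma dh_sum (I : Type) (r : seq I) (f : I -> U -> R) : (forall i, smooth (f i)) ->
  dh (fun u => \sum_(i <- r) f i u) = fun u => \sum_(i <- r) dh (f i) u.
Proof. by move=> sf; apply/funext => u; exact: derive_sumE. Qed.

Lemma eqhD k f g f' g' : smooth f -> smooth g -> smooth f' -> smooth g' ->
  eqh k f f' -> eqh k g g' -> eqh k (fun u => f u + g u) (fun u => f' u + g' u).
Proof.
elim: k f g f' g' => [//|k IH] f g f' g' sf sg sf' sg' [ef Ef] [eg Eg].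
split=> [z|]; first by rewrite ef eg.
by rewrite !dhD //; apply: IH => //; exact: smooth_dh.
Qed.

(** In each term of the Leibniz rule the differentiated factor is known to one order less, and the
    congruence of the other factor is weakened to match. *)
Lemma eqhM k f g f' g' : smooth f -> smooth g -> smooth f' -> smooth g' ->
  eqh k f f' -> eqh k g g' -> eqh k (fun u => f u * g u) (fun u => f' u * g' u).
Proof.
elim: k f g f' g' => [//|k IH] f g f' g' sf sg sf' sg' ef eg.
have /= [ef0 Ef] := ef; have /= [eg0 Eg] := eg.
split=> [z|]; first by rewrite ef0 eg0.
have sdf := smooth_dh sf; have sdf' := smooth_dh sf'.
have sdg := smooth_dh sg; have sdg' := smooth_dh sg'.
rewrite !dhM //; apply: eqhD; try exact: smoothM.
  by apply: IH => //; exact: eqh_le eg.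
by apply: IH => //; exact: eqh_le ef.
Qed.

Lemma eqhZ k (c : R) f f' : smooth f -> smooth f' ->
  eqh k f f' -> eqh k (fun u => c * f u) (fun u => c * f' u).
Proof.
by move=> sf sf' ef; apply: eqhM => //; try exact: smooth_cst; exact: eqh_refl.
Qed.

Lemma eqhB k f g f' g' : smooth f -> smooth g -> smooth f' -> smooth g' ->
  eqh k f f' -> eqh k g g' -> eqh k (fun u => f u - g u) (fun u => f' u - g' u).
Proof.
move=> sf sg sf' sg' ef eg; have NE (q : U -> R) : (fun u => - q u) = fun u => -1 * q u.
  by apply/funext => u; rewrite mulN1r.
by apply: eqhD => //; try exact: smoothN; rewrite !NE; exact: eqhZ.
Qed.

Lemma eqh_sum k (I : Type) (r : seq I) (f f' : I -> U -> R) :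
  (forall i, smooth (f i)) -> (forall i, smooth (f' i)) ->
  (forall i, eqh k (f i) (f' i)) ->
  eqh k (fun u => \sum_(i <- r) f i u) (fun u => \sum_(i <- r) f' i u).
Proof.
move=> sf sf' ef; elim: r => [|i r IH].
  rewrite (_ : (fun u => \sum_(i <- [::]) f i u) = (fun u => \sum_(i <- [::]) f' i u)).
    exact: eqh_refl.
  by apply/funext => u; rewrite !big_nil.
have E (q : I -> U -> R) :
    (fun u => \sum_(j <- i :: r) q j u) = fun u => q i u + \sum_(j <- r) q j u.
  by apply/funext => u; rewrite big_cons.
by rewrite !E; apply: eqhD => //; exact: smooth_sum.
Qed.

(** At [h = 0] the functions agree for every [z], hence so do their derivatives in [z]; higher
    orders follow because [dz] commutes with [dh]. *)
Lemma eqh_dz k v f g : smooth f -> smooth g -> eqh k f g -> eqh k (dz v f) (dz v g).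
Proof.
elim: k f g => [//|k IH] f g sf sg [e E]; split=> [z|].
  by rewrite !dzE; congr (derive _ _ _); apply/funext => t; exact: e.
by rewrite !dh_dz //; apply: IH => //; exact: smooth_dh.
Qed.

(** The source of the gain of one order: the derivative of [u.1 * f u] is [f u] plus a term of the
    original form with [dh f]. *)
Lemma eqh_mulh k f g : smooth f -> smooth g -> eqh k f g ->
  eqh k.+1 (fun u => u.1 * f u) (fun u => u.1 * g u).
Proof.
elim: k f g => [|k IH] f g sf sg e; split=> [z|]; rewrite ?mul0r //.
have E (q : U -> R) : smooth q -> dh (fun u => u.1 * q u) = fun u => q u + u.1 * dh q u.
  move=> sq; rewrite dhM //; last exact: smooth_h.
  by apply/funext => u; rewrite dh_h mul1r.
rewrite !E //; have [sdf sdg] := (smooth_dh sf, smooth_dh sg).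
apply: eqhD => //; try by apply: smoothM => //; exact: smooth_h.
by apply: IH => //; case: e.
Qed.

Lemma eqh_flat N f z : eqh N.+1 f (fun=> 0) -> flat_upto N (fun h => f (h, z)).
Proof.
move=> /eqhP e k kN; rewrite derive1n_section e //.
by rewrite -(derive1n_section _ (fun=> 0)); elim: k {kN} => [//|k IH];
   rewrite derive1Sn (_ : derive1 _ = fun=> 0) //;
   apply/funext => t; exact: derive1_cst.
Qed.

Lemma eqh_sub0 k f g : smooth f -> smooth g -> eqh k f g ->
  eqh k (fun u => f u - g u) (fun=> 0).
Proof.
move=> sf sg e; rewrite (_ : (fun=> 0) = fun u => g u - g u).
  by apply: eqhB => //; exact: eqh_refl.
by apply/funext => u; rewrite subrr.
Qed.

(** * Taylor coefficients in [h] and truncated series *)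

Definition hcoef k f z : R := (k`!)%:R^-1 * iter k dh f (0, z).

Lemma smooth_hcoef k f : smooth f -> smooth (hcoef k f).
Proof.
by move=> sf; apply: smoothZ; apply: smooth_section; exact: smooth_iter_dh.
Qed.

Lemma smooth_hX k (c : V -> R) : smooth c -> smooth (fun u : U => u.1 ^+ k * c u.2).
Proof.
move=> sc; apply: smoothM; last exact: smooth_comp_snd.
by apply: smoothX; exact: smooth_h.
Qed.

Lemma dh_hX k (c : V -> R) : smooth c ->
  dh (fun u => u.1 ^+ k * c u.2) = fun u => k%:R * (u.1 ^+ k.-1 * c u.2).
Proof.
move=> sc; apply/funext => -[h z]; rewrite dhE /=.
rewrite (@derive1Mr _ (fun h : R => h ^+ k)); last exact: exprn_derivable.
by rewrite exp_derive1 -mulr_natl mulrA.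
Qed.

Lemma iter_dh_hX j k (c : V -> R) : smooth c ->
  iter j dh (fun u => u.1 ^+ k * c u.2) =
  fun u => (k ^_ j)%:R * (u.1 ^+ (k - j) * c u.2).
Proof.
move=> sc; elim: j => [|j IH]; first by apply/funext => u; rewrite /= subn0 ffactn0 mul1r.
rewrite iterS IH; apply/funext => u; rewrite [LHS]deriveZE; last exact: smooth_hX.
have -> : 'D_(1, 0) (fun u : U => u.1 ^+ (k - j) * c u.2) u =
   (k - j)%:R * (u.1 ^+ (k - j).-1 * c u.2) by have := congr1 (@^~ u) (dh_hX (k - j) sc).
by rewrite mulrA -natrM ffactnSr subnS.
Qed.

Lemma iter_dh_sum j (I : Type) (r : seq I) (f : I -> U -> R) : (forall i, smooth (f i)) ->
  iter j dh (fun u => \sum_(i <- r) f i u) = fun u => \sum_(i <- r) iter j dh (f i) u.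
Proof.
move=> sf; elim: j => [//|j IH]; rewrite iterS IH dh_sum // => i.
exact: smooth_iter_dh.
Qed.

Lemma eqh_trunc N (c : nat -> V -> R) F : (forall k, smooth (c k)) ->
  (forall k, (k <= N)%N -> c k = hcoef k F) ->
  eqh N.+1 (fun u => \sum_(k < N.+1) u.1 ^+ k * c k u.2) F.
Proof.
move=> sc cF; apply/eqhP => j jN z.
rewrite iter_dh_sum => [|i]; last exact: smooth_hX.
rewrite (bigD1 (Ordinal jN)) //= big1 => [|i ij].
  rewrite iter_dh_hX // subnn expr0 mul1r addr0 ffactnn cF // /hcoef mulrA.
  by rewrite mulfV ?mul1r // pnatr_eq0 -lt0n fact_gt0.
rewrite iter_dh_hX //=; have [ji|ij'|ij'] := ltngtP j i.
(* For [j < i] a power of [h] survives and vanishes at [h = 0]; for [j > i] the falling factorial is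
   zero. *)
- by rewrite expr0n subn_eq0 leqNgt ji /= mul0r mulr0.
- by rewrite ffact_small // mul0r.
- by case/eqP: ij; apply: val_inj.
Qed.

(* The coefficient of [h^k] is read off the [k]-th approximation. *)
Lemma eqh_limit N (F : nat -> U -> R) : (forall k, smooth (F k)) ->
  (forall k, eqh k.+1 (F k.+1) (F k)) ->
  eqh N.+1 (fun u => \sum_(k < N.+1) u.1 ^+ k * hcoef k (F k) u.2) (F N).
Proof.
move=> sF eF; apply: (@eqh_trunc N (fun k => hcoef k (F k))) => [k|k kN]; first exact: smooth_hcoef.
(* From the [k]-th approximation on, the coefficient of [h^k] no longer changes, so it may be read
   off [F N]. *)
apply/funext => z; congr (_ * _); have /eqhP -> // : eqh k.+1 (F k) (F N).
rewrite -(subnKC kN); elim: (N - k)%N => [|d IH]; first by rewrite addn0; exact: eqh_refl.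
apply: eqh_trans IH _; apply: eqh_sym; rewrite addnS; apply: eqh_le (eF _).
by rewrite ltnS leq_addr.
Qed.

End HAdic.

(** * Functions on jet space *)

Section Jets.
Context {R : realType} {n : nat}.
Implicit Types (F : @jet R n -> R) (Y : @jet R n).

(** Jets carry no norm; derivatives are taken on the matrix of the first [m] entries, and [jet_of]
    pads with zeros on the way back. *)
Definition jtrunc m Y : 'M[R]_(m, n) := \matrix_(j, i) Y j 0 i.

Lemma jet_of_jtrunc m Y j : (j < m)%N -> jet_of (jtrunc m Y) j = Y j.
Proof.
move=> jm; apply/rowP => i; rewrite mxE insubT mxE /=.
by [].
Qed.

Lemma jtruncK m (A : 'M[R]_(m, n)) : jtrunc m (jet_of A) = A.
Proof. by apply/matrixP => j i; rewrite !mxE valK. Qed.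

(** [jet_smooth] with its bound exposed, since a total derivative raises the bound by one and the
    count has to be kept. *)
Definition jsmooth m F := depends_on m F /\ smooth (fun A : 'M[R]_(m, n) => F (jet_of A)).

Lemma depends_on_jtrunc m F : depends_on m F -> forall Y, F Y = F (jet_of (jtrunc m Y)).
Proof. by move=> dF Y; apply: dF => j jm; rewrite jet_of_jtrunc. Qed.

Lemma depends_on_le m m' F : (m <= m')%N -> depends_on m F -> depends_on m' F.
Proof. by move=> mm' dF Y Z YZ; apply: dF => j jm; apply: YZ; exact: leq_trans mm'. Qed.

Lemma depends_on_pd m j i F : depends_on m F -> depends_on m (pd j i F).
Proof.
move=> dF Y Z YZ; rewrite /pd.
rewrite (_ : (fun s : R => F (upd Y _ _)) = (fun s : R => F (upd Z j (Z j + s *: delta_mx 0 i)))) //.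
apply/funext => s; apply: dF => l lm; rewrite /upd.
by case: eqP => [<-|_]; rewrite YZ.
Qed.

Lemma pd_eq0 m j i F : depends_on m F -> (m <= j)%N -> pd j i F = fun=> 0.
Proof.
move=> dF mj; apply/funext => Y.
rewrite /pd (_ : (fun s : R => _) = cst (F Y)); first exact: derive1_cst.
apply/funext => s; apply: dF => l lm; rewrite /upd.
by case: eqP lm => // ->; rewrite ltnNge mj.
Qed.

Lemma pdE m F (j : 'I_m) i Y : jsmooth m F ->
  pd j i F Y = 'D_(delta_mx j i) (fun A : 'M[R]_(m, n) => F (jet_of A)) (jtrunc m Y).
Proof.
move=> [dF sF]; rewrite /pd.
rewrite (_ : (fun s : R => F _) =
  fun s : R => F (jet_of (s *: delta_mx j i + jtrunc m Y))).
  rewrite derive1E (@derive_line _ _ (fun A : 'M[R]_(m, n) => F (jet_of A))).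
  by rewrite scale0r add0r.
apply/funext => s; rewrite (depends_on_jtrunc dF); congr (F (jet_of _)).
apply/matrixP => l p; rewrite !mxE /upd.
case: (eqVneq (l : nat) j) => [/val_inj ->|lj].
  by rewrite !mxE !eqxx addrC.
by rewrite (_ : (l == j) = false) ?mulr0 ?add0r //; apply/negbTE.
Qed.

Definition jetf (U : Type) (P : nat -> 'I_n -> U -> R) (u : U) : @jet R n :=
  fun j => \row_i P j i u.

Section ChainRule.
Context {V : normedModType R}.
Variable P : nat -> 'I_n -> V -> R.
Hypothesis sP : forall j i, smooth (P j i).

Lemma jtrunc_jetf m u : jtrunc m (jetf P u) = \matrix_(j, i) P j i u.
Proof. by apply/matrixP => j i; rewrite !mxE. Qed.

Lemma jsmooth_jetf m F : jsmooth m F -> smooth (fun u => F (jetf P u)).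
Proof.
move=> [dF sF].
rewrite (_ : (fun u => _) = fun u => F (jet_of (\matrix_(j < m, i < n) P j i u))).
  by apply: (@smooth_comp_mx _ _ m n (fun A : 'M[R]_(m, n) => F (jet_of A))
               (fun j i => P j i)).
by apply/funext => u; rewrite (depends_on_jtrunc dF) jtrunc_jetf.
Qed.

Lemma derive_jetf m F v u : jsmooth m F ->
  'D_v (fun u => F (jetf P u)) u =
  \sum_(j < m) \sum_i pd j i F (jetf P u) * 'D_v (P j i) u.
Proof.
move=> jF; have [dF sF] := jF.
rewrite (_ : (fun u => _) = fun u => F (jet_of (\matrix_(j < m, i < n) P j i u))).
  rewrite (@derive_comp_mx _ _ m n (fun A : 'M[R]_(m, n) => F (jet_of A))
               (fun j i => P j i)) //; last 2 first.
  - by move=> j i; exact: smooth_differentiable.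
  - exact: smooth_differentiable.
  apply: eq_bigr => j _; apply: eq_bigr => i _; congr (_ * _).
  by rewrite (pdE _ _ _ jF) jtrunc_jetf.
by apply/funext => w; rewrite (depends_on_jtrunc dF) jtrunc_jetf.
Qed.

End ChainRule.

Lemma smooth_jet_of m j (i : 'I_n) : smooth (fun A : 'M[R]_(m, n) => jet_of A j 0 i).
Proof.
have [jm|mj] := ltnP j m.
  rewrite (_ : (fun A => _) = fun A : 'M[R]_(m, n) => A (Ordinal jm) i).
    exact: smooth_coord.
  by apply/funext => A; rewrite mxE insubT.
rewrite (_ : (fun A => _) = fun=> 0); first exact: smooth_cst.
by apply/funext => A; rewrite mxE insubN // -leqNgt.
Qed.

(** The bound witnessing smoothness and the bound on dependence may come from different sources, in
    either order. The entries of [jet_of A] are coordinates of [A] or zero, so the composite is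
    smooth for any number of rows. *)
Lemma jsmooth_trans m m' F : jsmooth m F -> depends_on m' F -> jsmooth m' F.
Proof.
move=> jF dF; split=> //.
rewrite (_ : (fun A => _) = fun A : 'M[R]_(m', n) => F (jetf (fun j i A => jet_of A j 0 i) A)).
  by apply: (jsmooth_jetf _ jF) => j i; exact: smooth_jet_of.
by apply/funext => A; congr F; apply/funext => j; apply/rowP => i; rewrite !mxE.
Qed.

Lemma jsmooth_le m m' F : (m <= m')%N -> jsmooth m F -> jsmooth m' F.
Proof. by move=> mm' jF; apply: (jsmooth_trans jF); apply: depends_on_le mm' _; case: jF. Qed.

Lemma jsmooth_pd m j i F : jsmooth m F -> jsmooth m (pd j i F).
Proof.
move=> jF; have [dF sF] := jF; split; first exact: depends_on_pd.
have [jm|mj] := ltnP j m; last first.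
  by rewrite (pd_eq0 i dF mj); exact: smooth_cst.
rewrite (_ : (fun A => _) = 'D_(delta_mx (Ordinal jm) i)
  (fun A : 'M[R]_(m, n) => F (jet_of A))); first exact: smooth_derive.
by apply/funext => A; rewrite (pdE (Ordinal jm) _ _ jF) jtruncK.
Qed.

Lemma Dt_small d K F : depends_on d F -> (d <= K)%N -> Dt K F = Dt d F.
Proof.
move=> dF dK; apply/funext => Y.
rewrite /Dt -!(big_mkord xpredT (fun j => \sum_(i < n) pd j i F Y * Y j.+1 0 i)).
rewrite (big_cat_nat (leq0n d) dK) //= [X in _ + X]big_nat_cond [X in _ + X]big1 ?addr0 // => j.
rewrite andbT => /andP[dj _]; rewrite big1 // => i _.
by rewrite (pd_eq0 i dF dj) mul0r.
Qed.

Lemma jsmooth_Dt d K F : jsmooth d F -> (d <= K)%N -> jsmooth d.+1 (Dt K F).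
Proof.
move=> jF dK; rewrite (Dt_small (proj1 jF) dK); split.
  move=> Y Z YZ; apply: eq_bigr => j _; apply: eq_bigr => i _.
  rewrite YZ ?ltnS //; congr (_ * _).
  by apply: (depends_on_pd j i (proj1 jF)) => l ld; apply: YZ; exact: ltnW.
apply: smooth_sum => j _; apply: smooth_sum => i _; apply: smoothM.
  by have [] := jsmooth_le (leqnSn d) (jsmooth_pd j i jF).
exact: smooth_jet_of.
Qed.

Lemma pd_lincomb m (I : Type) (r : seq I) (c : I -> R) (F : I -> @jet R n -> R) j i :
  (forall k, jsmooth m (F k)) ->
  pd j i (fun Y => \sum_(k <- r) c k * F k Y) = fun Y => \sum_(k <- r) c k * pd j i (F k) Y.
Proof.
move=> jF.
have dS : depends_on m (fun Y => \sum_(k <- r) c k * F k Y).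
  by move=> Y Z YZ; apply: eq_bigr => k _; rewrite (proj1 (jF k) Y Z YZ).
have sS k : smooth (fun A : 'M[R]_(m, n) => c k * F k (jet_of A)).
  by apply: smoothZ; have [] := jF k.
have [jm|mj] := ltnP j m; last first.
  rewrite (pd_eq0 i dS mj); apply/funext => Y; rewrite big1 // => k _.
  by rewrite (pd_eq0 i (proj1 (jF k)) mj) mulr0.
apply/funext => Y; have jS : jsmooth m (fun Y => \sum_(k <- r) c k * F k Y).
  by split=> //; apply: smooth_sum => k _; exact: sS.
rewrite (pdE (Ordinal jm) i Y jS) derive_sumE //.
apply: eq_bigr => k _; rewrite (pdE (Ordinal jm) i Y (jF k)).
by apply: deriveZE; have [] := jF k.
Qed.

Lemma jsmooth_lincomb m (I : Type) (r : seq I) (c : I -> R) (F : I -> @jet R n -> R) :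
  (forall k, jsmooth m (F k)) -> jsmooth m (fun Y => \sum_(k <- r) c k * F k Y).
Proof.
move=> jF; split.
  by move=> Y Z YZ; apply: eq_bigr => k _; rewrite (proj1 (jF k) Y Z YZ).
by apply: smooth_sum => k _; apply: smoothZ; have [] := jF k.
Qed.

End Jets.

(** * Substitution of congruent families into jet functions *)

Section JetCongruence.
Context {R : realType} {n : nat} {V : normedModType R}.
Notation U := (R * V)%type.

(** Induction on [k] for all [F] at once: the chain rule expresses [dh] through the functions
    [pd j i F], which are again [jsmooth m] and are needed only one order lower. *)
Lemma eqh_jetf k m (F : @jet R n -> R) (P Q : nat -> 'I_n -> U -> R) :
  jsmooth m F ->
  (forall j i, smooth (P j i)) -> (forall j i, smooth (Q j i)) ->
  (forall j i, eqh k (P j i) (Q j i)) ->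
  eqh k (fun u => F (jetf P u)) (fun u => F (jetf Q u)).
Proof.
move=> jF sP sQ; elim: k F jF => [//|k IH] F jF ePQ; split=> [z|].
  congr F; apply/funext => j; apply/rowP => i; rewrite !mxE.
  by have [-> _] := ePQ j i.
have dE (A : nat -> 'I_n -> U -> R) : (forall j i, smooth (A j i)) ->
   dh (fun u => F (jetf A u)) = fun u => \sum_(j < m) \sum_(i < n) pd j i F (jetf A u) * dh (A j i) u.
  by move=> sA; apply/funext => u; exact: derive_jetf.
have sM (A : nat -> 'I_n -> U -> R) j i : (forall j i, smooth (A j i)) ->
    smooth (fun u => pd j i F (jetf A u)).
  by move=> sA; apply: (jsmooth_jetf sA (jsmooth_pd j i jF)).
have sD (A : nat -> 'I_n -> U -> R) j i : (forall j i, smooth (A j i)) ->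
    smooth (dh (A j i)) by move=> sA; exact: smooth_dh.
rewrite !dE //; apply: eqh_sum => [j|j|j].
- by apply: smooth_sum => i _; apply: smoothM; [exact: sM|exact: sD].
- by apply: smooth_sum => i _; apply: smoothM; [exact: sM|exact: sD].
apply: eqh_sum => [i|i|i].
- by apply: smoothM; [exact: sM|exact: sD].
- by apply: smoothM; [exact: sM|exact: sD].
apply: eqhM; [exact: sM|exact: sD|exact: sM|exact: sD| |by have [] := ePQ j i].
by apply: IH (jsmooth_pd j i jF) _ => l p; exact: eqh_le (ePQ l p).
Qed.

End JetCongruence.

(** * Flow of a second order equation and first variation formula *)

Section Flow.
Context {R : realType} {n : nat}.
Notation Z := 'rV[R]_(n + n).
Notation U := (R * Z)%type.
Implicit Types (f : U -> R) (G : 'I_n -> U -> R) (u : U) (a b : 'I_(n + n)).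

Definition pz a f : U -> R := dz (delta_mx 0 a) f.

Definition vel G a : U -> R :=
  match fintype.split a with
  | inl i => fun u => u.2 0 (rshift n i)
  | inr i => G i
  end.

(* The derivative along [y'' = G(h, y, y')], with [h] frozen. *)
Definition flowD G f : U -> R := fun u => \sum_a vel G a u * pz a f u.

Lemma smooth_coordz a : smooth (fun u : U => u.2 0 a).
Proof. by apply: (@smooth_comp_snd _ _ _ (fun z : Z => z 0 a)); exact: smooth_coord. Qed.

Lemma pz_coordz a b u : pz a (fun u => u.2 0 b) u = (a == b)%:R.
Proof.
by case: u => h z; rewrite /pz dzE /= derive_coord mxE eqxx eq_sym.
Qed.

Lemma smooth_pz a f : smooth f -> smooth (pz a f).
Proof. exact: smooth_dz. Qed.

Lemma smooth_vel G a : (forall i, smooth (G i)) -> smooth (vel G a).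
Proof. by move=> sG; rewrite /vel; case: fintype.split => i //; exact: smooth_coordz. Qed.

Lemma smooth_flowD G f : (forall i, smooth (G i)) -> smooth f -> smooth (flowD G f).
Proof.
move=> sG sf; apply: smooth_sum => a _; apply: smoothM; first exact: smooth_vel.
exact: smooth_pz.
Qed.

Lemma velE G u : \row_a vel G a u = row_mx (rsubmx u.2) (\row_i G i u).
Proof.
apply/rowP => a; rewrite mxE /vel.
have := splitK a; case: (fintype.split a) => i <- /=.
  by rewrite row_mxEl mxE.
by rewrite row_mxEr mxE.
Qed.

(** The coordinate sum makes smoothness evident although the direction varies with [u]; the
    directional form is the one met in [prol] and in the chain rule. *)
Lemma flowDE G f u : smooth f -> flowD G f u = dz (\row_a vel G a u) f u.
Proof.
move=> sf; have df := smooth_differentiable sf u.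
rewrite /dz deriveE // (_ : (0, _) = \sum_a vel G a u *: ((0, delta_mx 0 a) : U)).
  rewrite linear_sum; apply: eq_bigr => a _.
  by rewrite linearZ /= /pz /dz deriveE.
rewrite [X in (0, X)]row_sum_delta.
have -> : \sum_a vel G a u *: ((0, delta_mx 0 a) : U) =
    (0, \sum_a vel G a u *: delta_mx 0 a).
  elim/big_ind2: _ => [//|x1 x2 y1 y2 -> ->|a _].
    by congr pair; rewrite /= addr0.
  by congr pair; rewrite /= scaler0.
by congr pair; apply: eq_bigr => a _; rewrite mxE.
Qed.

Lemma flowD_coordz G a u : flowD G (fun u => u.2 0 a) u = vel G a u.
Proof.
rewrite /flowD (bigD1 a) //= pz_coordz eqxx mulr1 big1 ?addr0 // => b ba.
by rewrite pz_coordz (negbTE ba) mulr0.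
Qed.

Lemma flowD_lincomb G (I : Type) (r : seq I) (c : I -> R) (f : I -> U -> R) :
  (forall k, smooth (f k)) ->
  flowD G (fun u => \sum_(k <- r) c k * f k u) = fun u => \sum_(k <- r) c k * flowD G (f k) u.
Proof.
move=> sf; apply/funext => u; rewrite /flowD.
under [RHS]eq_bigr do rewrite big_distrr.
rewrite [RHS]exchange_big; apply: eq_bigr => a _; rewrite /pz /dz.
rewrite derive_sumE => [|k]; last exact: smoothZ.
rewrite big_distrr; apply: eq_bigr => k _ /=.
by rewrite deriveZE // mulrCA.
Qed.

Lemma iter_flowD_lincomb G t (I : Type) (r : seq I) (c : I -> R) (f : I -> U -> R) :
  (forall i, smooth (G i)) -> (forall k, smooth (f k)) ->
  iter t (flowD G) (fun u => \sum_(k <- r) c k * f k u) =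
  fun u => \sum_(k <- r) c k * iter t (flowD G) (f k) u.
Proof.
move=> sG sf; elim: t => [//|t IH]; rewrite iterS IH flowD_lincomb // => k.
by elim: {IH} t => //= t; exact: smooth_flowD.
Qed.

Lemma smooth_iter_flowD G t f : (forall i, smooth (G i)) -> smooth f ->
  smooth (iter t (flowD G) f).
Proof. by move=> sG sf; elim: t => //= t; exact: smooth_flowD. Qed.

(** [prol] with [h] kept as a variable, so that it can be differentiated in [h]; [prolE] identifies
    the two at frozen [h]. *)
Fixpoint prolU G (j : nat) (i : 'I_n) : U -> R :=
  if j is j'.+1 then flowD G (prolU G j' i) else fun u => u.2 0 (lshift n i).

Lemma smooth_prolU G j i : (forall i, smooth (G i)) -> smooth (prolU G j i).
Proof.
by move=> sG; elim: j => [|j IH]; [exact: smooth_coordz|exact: smooth_flowD].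
Qed.

Lemma prolU1 G i : prolU G 1 i = fun u => u.2 0 (rshift n i).
Proof.
by apply/funext => u; rewrite /= flowD_coordz /vel -[lshift n i]/(unsplit (inl i)) unsplitK.
Qed.

Lemma prolU2 G i : prolU G 2 i = G i.
Proof.
rewrite -[LHS]/(flowD G (prolU G 1 i)) prolU1; apply/funext => u; rewrite flowD_coordz.
by rewrite /vel -[rshift n i]/(unsplit (inr i)) unsplitK.
Qed.

Lemma prolE G j (h : R) z : (forall i, smooth (G i)) ->
  prol (fun z => \row_i G i (h, z)) j z = \row_i prolU G j i (h, z).
Proof.
move=> sG; elim: j z => [|j IH] z.
  by apply/rowP => i; rewrite !mxE.
rewrite /= (funext IH) derive_mxE => [|_ i]; last first.
  by apply: smooth_differentiable; apply: smooth_section; exact: smooth_prolU.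
apply/rowP => i; rewrite !mxE flowDE; last exact: smooth_prolU.
by rewrite velE dzE.
Qed.

(** [Dt] sends [y^(j)] to [y^(j+1)], and [flowD] sends [prolU G j] to [prolU G j.+1] by definition;
    the chain rule carries this over to [F]. *)
Lemma flowD_jetf G m K F : (forall i, smooth (G i)) -> jsmooth m F -> (m <= K)%N ->
  flowD G (fun u => F (jetf (prolU G) u)) = fun u => Dt K F (jetf (prolU G) u).
Proof.
move=> sG jF mK; rewrite (Dt_small (proj1 jF) mK); apply/funext => u.
have sP j i : smooth (prolU G j i) by exact: smooth_prolU.
rewrite flowDE; last exact: (jsmooth_jetf sP jF).
rewrite [LHS](derive_jetf sP _ _ jF); apply: eq_bigr => j _; apply: eq_bigr => i _.
by rewrite mxE /= flowDE.
Qed.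

Lemma iter_flowD_jetf G m t K F : (forall i, smooth (G i)) -> jsmooth m F ->
  (m + t <= K)%N ->
  iter t (flowD G) (fun u => F (jetf (prolU G) u)) =
    (fun u => iter t (Dt K) F (jetf (prolU G) u)).
Proof.
move=> sG jF mtK.
have [-> _] : iter t (flowD G) (fun u => F (jetf (prolU G) u)) =
    (fun u => iter t (Dt K) F (jetf (prolU G) u)) /\ jsmooth (m + t) (iter t (Dt K) F).
  elim: t mtK => [|t IH] mtK; first by rewrite addn0.
  have [e jt] := IH (leq_trans (leq_add (leqnn m) (leqnSn t)) mtK).
  rewrite addnS in mtK; rewrite iterS e (flowD_jetf sG jt (ltnW mtK)); split=> //.
  by rewrite addnS; apply: jsmooth_Dt => //; exact: ltnW.
by [].
Qed.

(* [ostro m F G j] is the [j]-th Ostrogradsky momentum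
   [sum_r (-d/dt)^r (dF/dy^(j+r))] along the flow; [j = 0] is the
   Euler-Lagrange expression. *)
Definition ostro m (F : @jet R n -> R) G (j : nat) (i : 'I_n) : U -> R := fun u =>
  \sum_(r < m - j) (-1) ^+ r *
    iter r (flowD G) (fun u => pd (j + r) i F (jetf (prolU G) u)) u.

(** * Momenta, canonical one-form, energy and the first variation formula *)

Section Noether.
Variables (m : nat) (F : @jet R n -> R).
Hypothesis jF : jsmooth m F.

(** Terms with [j >= m] differentiate in entries that [F] does not see. The freedom in [K] lets
    Lagrangians with different jet bounds be compared. *)
Lemma EL_ostro K G u i : (forall i, smooth (G i)) -> (m <= K)%N ->
  EL K F (jetf (prolU G) u) i = ostro m F G 0 i u.
Proof.
move=> sG mK; rewrite /EL /ostro subn0.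
rewrite -!(big_mkord xpredT (fun j => (-1) ^+ j * iter j (Dt (2 * K)) (pd j i F) (jetf (prolU G) u))).
rewrite -!(big_mkord xpredT (fun j => (-1) ^+ j * iter j (flowD G) (fun u => pd (0 + j) i F (jetf (prolU G) u)) u)).
rewrite (big_cat_nat (leq0n m) mK) /= [X in _ + X]big_nat_cond [X in _ + X]big1 ?addr0 => [|j].
  apply: eq_big_nat => j /andP[_ jm]; rewrite add0n.
  (* Each [Dt] may add one jet entry; [j < m <= K] keeps [m + j] within [2 * K]. *)
  rewrite (@iter_flowD_jetf G m j (2 * K)) //; first exact: jsmooth_pd.
  by rewrite mul2n -addnn leq_add // (leq_trans (ltnW jm)).
rewrite andbT => /andP[mj _]; rewrite (pd_eq0 i (proj1 jF) mj).
rewrite (_ : iter j _ _ = fun=> 0) ?mulr0 //.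
elim: {mj} j => //= j ->; apply/funext => Y; rewrite /Dt big1 // => l _; rewrite big1 // => p _.
by rewrite (@pd_eq0 _ _ 0) ?mul0r // => ? ?.
Qed.

Lemma smooth_pd_flow G j i : (forall i, smooth (G i)) ->
  smooth (fun u => pd j i F (jetf (prolU G) u)).
Proof.
move=> sG; apply: (jsmooth_jetf _ (jsmooth_pd j i jF)) => l p; exact: smooth_prolU.
Qed.

Lemma smooth_ostro G j i : (forall i, smooth (G i)) -> smooth (ostro m F G j i).
Proof.
move=> sG; apply: smooth_sum => r _; apply: smoothZ; apply: smooth_iter_flowD => //.
exact: smooth_pd_flow.
Qed.

Lemma ostro_ge G j i u : (m <= j)%N -> ostro m F G j i u = 0.
Proof. by rewrite /ostro => /eqP ->; rewrite big_ord0. Qed.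

(** Ostrogradsky's recursion: [flowD] shifts the alternating sum by one place and flips its sign,
    and the first term, now missing, is [dF/dy^(j)]. *)
Lemma flowD_ostro G j i u : (forall i, smooth (G i)) -> (j < m)%N ->
  flowD G (ostro m F G j.+1 i) u = pd j i F (jetf (prolU G) u) - ostro m F G j i u.
Proof.
move=> sG jm; rewrite /ostro flowD_lincomb; last first.
  by move=> r; apply: smooth_iter_flowD => //; exact: smooth_pd_flow.
rewrite -(subnSK jm) big_ord_recl /= expr0 mul1r addn0 opprD addNKr -sumrN.
apply: eq_bigr => r _; rewrite /bump /= add1n addSnnS exprS mulN1r mulNr opprK.
by [].
Qed.

(** The component along [dz_b] of the pulled-back canonical one-form. The momentum conjugate to
    [y^(j)] has index [j.+1], as index [0] is the Euler-Lagrange expression. *)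
Definition theta G b : U -> R := fun u =>
  \sum_(j < m) \sum_i ostro m F G j.+1 i u * pz b (prolU G j i) u.

Definition ham G : U -> R := fun u =>
  \sum_(j < m) \sum_i ostro m F G j.+1 i u * prolU G j.+1 i u - F (jetf (prolU G) u).

Lemma smooth_theta G b : (forall i, smooth (G i)) -> smooth (theta G b).
Proof.
move=> sG; apply: smooth_sum => j _; apply: smooth_sum => i _; apply: smoothM.
  exact: smooth_ostro.
by apply: smooth_pz; exact: smooth_prolU.
Qed.

Lemma smooth_ham G : (forall i, smooth (G i)) -> smooth (ham G).
Proof.
move=> sG; apply: smoothB; last first.
  by apply: (jsmooth_jetf _ jF) => j i; exact: smooth_prolU.
apply: smooth_sum => j _; apply: smooth_sum => i _; apply: smoothM.
  exact: smooth_ostro.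
exact: smooth_prolU.
Qed.

Lemma pz_theta G a b u : (forall i, smooth (G i)) ->
  pz a (theta G b) u = \sum_(j < m) \sum_i
   (pz a (ostro m F G j.+1 i) u * pz b (prolU G j i) u +
    ostro m F G j.+1 i u * pz a (pz b (prolU G j i)) u).
Proof.
move=> sG; have so j i := smooth_ostro j i sG; have sp j i := smooth_prolU j i sG.
have spp j i : smooth (pz b (prolU G j i)) by exact: smooth_pz.
rewrite /theta [LHS]derive_sumE; last first.
  by move=> j; apply: smooth_sum => i _; exact: smoothM.
apply: eq_bigr => j _; rewrite [LHS]derive_sumE; last by move=> i; exact: smoothM.
by apply: eq_bigr => i _; rewrite [LHS]deriveME.
Qed.

(** [s] and [s'] will be the two orders of second derivatives of a prolongation; they cancel, and
    contracting with [v] leaves two flow derivatives. *)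
Lemma contraction (I : finType) (p s s' y v : I -> R) (x o q : R) : s =1 s' ->
  \sum_b (x * p b + o * s b - (y b * q + o * s' b)) * v b =
  x * (\sum_b v b * p b) - (\sum_b v b * y b) * q.
Proof.
move=> e; rewrite mulr_sumr mulr_suml -sumrB; apply: eq_bigr => b _.
by rewrite e; ring.
Qed.

(* The first variation formula: contracting [d theta] with the flow gives
   [d ham] up to the Euler-Lagrange expression. *)
Lemma noether G a u : (forall i, smooth (G i)) ->
  \sum_b (pz a (theta G b) u - pz b (theta G a) u) * vel G b u =
  pz a (ham G) u + \sum_i ostro m F G 0 i u * pz a (prolU G 0 i) u.
Proof.
move=> sG; have so j i := smooth_ostro j i sG; have sp j i := smooth_prolU j i sG.
have sL : smooth (fun u => F (jetf (prolU G) u)) by exact: (jsmooth_jetf sp jF).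
transitivity (\sum_(j < m) \sum_i (pz a (ostro m F G j.+1 i) u * prolU G j.+1 i u
   - flowD G (ostro m F G j.+1 i) u * pz a (prolU G j i) u)).
  under eq_bigr do rewrite !pz_theta // -sumrB big_distrl /=.
  rewrite exchange_big; apply: eq_bigr => j _.
  under eq_bigr do rewrite -sumrB big_distrl /=.
  rewrite exchange_big; apply: eq_bigr => i _.
  apply: (@contraction _ (fun b => pz b (prolU G j i) u)
    (fun b => pz a (pz b (prolU G j i)) u) (fun b => pz b (pz a (prolU G j i)) u)
    (fun b => pz b (ostro m F G j.+1 i) u) (fun b => vel G b u)) => b.
  exact: (congr1 (@^~ u) (dz_dz _ _ (sp j i))).
have -> : pz a (ham G) u = \sum_(j < m) \sum_i
    (pz a (ostro m F G j.+1 i) u * prolU G j.+1 i u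
     + ostro m F G j.+1 i u * pz a (prolU G j.+1 i) u
     - pd j i F (jetf (prolU G) u) * pz a (prolU G j i) u).
  rewrite /ham [LHS]deriveBE //; last first.
    by apply: smooth_sum => j _; apply: smooth_sum => i _; exact: smoothM.
  rewrite (derive_jetf sp _ _ jF) derive_sumE; last first.
    by move=> j; apply: smooth_sum => i _; exact: smoothM.
  rewrite -sumrB; apply: eq_bigr => j _; rewrite derive_sumE; last first.
    by move=> i; exact: smoothM.
  by rewrite -sumrB; apply: eq_bigr => i _; rewrite deriveME.
(* Spread into a telescoping sum over [j], whose upper end vanishes since the momentum of index [m]
   is zero; the identity can then be checked for each [j] and [i]. *)
have -> : \sum_i ostro m F G 0 i u * pz a (prolU G 0 i) u =
   \sum_(j < m) \sum_i (ostro m F G j i u * pz a (prolU G j i) u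
      - ostro m F G j.+1 i u * pz a (prolU G j.+1 i) u).
  rewrite exchange_big; apply: eq_bigr => i _ /=.
  rewrite -(big_mkord xpredT (fun j => ostro m F G j i u * pz a (prolU G j i) u -
     ostro m F G j.+1 i u * pz a (prolU G j.+1 i) u)).
  pose o j := - (ostro m F G j i u * pz a (prolU G j i) u).
  rewrite (eq_bigr (fun j => o j.+1 - o j)) => [|j _]; last by rewrite /o opprK addrC.
  by rewrite telescope_sumr // /o opprK (@ostro_ge G m) // mul0r oppr0 add0r.
rewrite -big_split; apply: eq_bigr => j _; rewrite -big_split; apply: eq_bigr => i _.
by rewrite flowD_ostro //=; ring.
Qed.

(** * Congruent flows give congruent momenta, one-forms and energies *)

Section Congruence.
Variables (k : nat) (G G' : 'I_n -> U -> R).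
Hypotheses (sG : forall i, smooth (G i)) (sG' : forall i, smooth (G' i)).
Hypothesis eG : forall i, eqh k (G i) (G' i).

Lemma eqh_flowD f f' : smooth f -> smooth f' -> eqh k f f' ->
  eqh k (flowD G f) (flowD G' f').
Proof.
move=> sf sf' ef; apply: eqh_sum => [a|a|a].
- by apply: smoothM; [exact: smooth_vel|exact: smooth_pz].
- by apply: smoothM; [exact: smooth_vel|exact: smooth_pz].
apply: eqhM; [exact: smooth_vel|exact: smooth_pz|exact: smooth_vel|exact: smooth_pz| |exact: eqh_dz].
by rewrite /vel; case: fintype.split => i //; exact: eqh_refl.
Qed.

Lemma eqh_prolU j i : eqh k (prolU G j i) (prolU G' j i).
Proof.
elim: j => [|j IH]; first exact: eqh_refl.
by apply: eqh_flowD => //; exact: smooth_prolU.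
Qed.

Lemma eqh_pd_flow j i :
  eqh k (fun u => pd j i F (jetf (prolU G) u)) (fun u => pd j i F (jetf (prolU G') u)).
Proof.
apply: (eqh_jetf (jsmooth_pd j i jF)) => [l p|l p|l p];
  by [exact: smooth_prolU|exact: eqh_prolU].
Qed.

Lemma eqh_ostro j i : eqh k (ostro m F G j i) (ostro m F G' j i).
Proof.
have si G0 r : (forall i, smooth (G0 i)) ->
    smooth (iter r (flowD G0) (fun u => pd (j + r) i F (jetf (prolU G0) u))).
  by move=> s0; apply: smooth_iter_flowD => //; exact: smooth_pd_flow.
apply: eqh_sum => [r|r|r]; try by apply: smoothZ; exact: si.
apply: eqhZ; try exact: si.
move: (j + r)%N => l; elim: (r : nat) => [|t IH]; first exact: eqh_pd_flow.
rewrite !iterS; apply: eqh_flowD => //; apply: smooth_iter_flowD => //; exact: smooth_pd_flow.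
Qed.

Lemma eqh_theta b : eqh k (theta G b) (theta G' b).
Proof.
have sM G0 j i : (forall i, smooth (G0 i)) ->
    smooth (fun u => ostro m F G0 j.+1 i u * pz b (prolU G0 j i) u).
  move=> s0; apply: smoothM; first exact: smooth_ostro.
  by apply: smooth_pz; exact: smooth_prolU.
apply: eqh_sum => [j|j|j]; try by apply: smooth_sum => i _; exact: sM.
apply: eqh_sum => [i|i|i]; try exact: sM.
have sp G0 : (forall i, smooth (G0 i)) -> smooth (prolU G0 j i) by move=> ?; exact: smooth_prolU.
apply: eqhM; try exact: smooth_ostro; try by apply: smooth_pz; exact: sp.
  exact: eqh_ostro.
by apply: eqh_dz; [exact: sp|exact: sp|exact: eqh_prolU].
Qed.

Lemma eqh_ham : eqh k (ham G) (ham G').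
Proof.
have sM G0 j i : (forall i, smooth (G0 i)) ->
    smooth (fun u => ostro m F G0 j.+1 i u * prolU G0 j.+1 i u).
  by move=> s0; apply: smoothM; [exact: smooth_ostro|exact: smooth_prolU].
have sF G0 : (forall i, smooth (G0 i)) -> smooth (fun u => F (jetf (prolU G0) u)).
  by move=> s0; apply: (jsmooth_jetf _ jF) => j i; exact: smooth_prolU.
apply: eqhB; try exact: sF; try by apply: smooth_sum => j _; apply: smooth_sum => i _; exact: sM.
  apply: eqh_sum => [j|j|j]; try by apply: smooth_sum => i _; exact: sM.
  apply: eqh_sum => [i|i|i]; try exact: sM.
  apply: eqhM; try exact: smooth_ostro; try exact: smooth_prolU.
    exact: eqh_ostro.
  exact: eqh_prolU.
apply: (eqh_jetf jF) => [l p|l p|l p]; by [exact: smooth_prolU|exact: eqh_prolU].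
Qed.

End Congruence.
End Noether.
End Flow.

(** * The modified equation *)

Section Construction.
Context {R : realType} {n : nat}.
Notation Z := 'rV[R]_(n + n).
Notation U := (R * Z)%type.
Variables (L : nat -> @jet R n -> R) (m : nat -> nat).
Hypothesis m0 : m 0 = 2%N.
Hypothesis jL : forall k, jsmooth (m k) (L k).
Hypothesis regL : forall Y, hess 1 (L 0%N) Y \in unitmx.

Definition jet2 (z : Z) : @jet R n := fun j => if j is 0 then lsubmx z else rsubmx z.

Lemma jsmooth_L0 : jsmooth 2 (L 0).
Proof. by rewrite -m0. Qed.

Lemma jetf_jet2 (F : @jet R n -> R) (G : 'I_n -> U -> R) u : depends_on 2 F ->
  F (jetf (prolU G) u) = F (jet2 u.2).
Proof.
move=> dF; apply: dF => -[|[|//]] _; apply/rowP => i; rewrite !mxE //.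
by rewrite prolU1.
Qed.

Lemma smooth_jet2 F : jsmooth 2 F -> smooth (fun z : Z => F (jet2 z)).
Proof.
move=> jF; have -> : (fun z : Z => F (jet2 z)) =
  fun z => F (jetf (fun j i (z : Z) => if j is 0 then z 0 (lshift n i) else z 0 (rshift n i)) z).
  apply/funext => z; congr F; apply/funext => j; apply/rowP => i.
  by case: j => [|j]; rewrite !mxE.
by apply: (jsmooth_jetf _ jF) => -[|j] i; exact: smooth_coord.
Qed.

Definition massmx (z : Z) : 'M[R]_n := hess 1 (L 0) (jet2 z).

Lemma smooth_massmx i j : smooth (fun z => massmx z i j).
Proof.
under eq_fun do rewrite mxE.
by apply: smooth_jet2; do 2 apply: jsmooth_pd; exact: jsmooth_L0.
Qed.

(** The part of the Euler-Lagrange expression of [L 0] that is free of acceleration. *)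
Definition force (i : 'I_n) (z : Z) : R :=
  pd 0 i (L 0) (jet2 z) - \sum_l pd 0 l (pd 1 i (L 0)) (jet2 z) * z 0 (rshift n l).

Lemma smooth_force i : smooth (force i).
Proof.
apply: smoothB; first by apply: smooth_jet2; apply: jsmooth_pd; exact: jsmooth_L0.
apply: smooth_sum => l _; apply: smoothM; last exact: smooth_coord.
by apply: smooth_jet2; do 2 apply: jsmooth_pd; exact: jsmooth_L0.
Qed.

Lemma ostro_L0 (G : 'I_n -> U -> R) i u : (forall i, smooth (G i)) ->
  ostro (m 0) (L 0) G 0 i u = force i u.2 - \sum_l G l u * massmx u.2 l i.
Proof.
move=> sG; have jp := jsmooth_pd 1 i jsmooth_L0.
rewrite m0 /ostro !big_ord_recl big_ord0 addr0 /= expr0 mul1r expr1 mulN1r.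
rewrite (jetf_jet2 _ _ (proj1 (jsmooth_pd _ i jsmooth_L0))).
rewrite (flowD_jetf sG jp (leqnn 2)) /Dt !big_ord_recl big_ord0 addr0 /=.
rewrite opprD addrA; congr (_ - _ - _); apply: eq_bigr => l _.
  rewrite (jetf_jet2 _ _ (proj1 (jsmooth_pd _ l jp))); congr (_ * _).
  by rewrite mxE prolU1.
rewrite (jetf_jet2 _ _ (proj1 (jsmooth_pd _ l jp))) [RHS]mulrC !mxE; congr (_ * _).
by rewrite prolU2.
Qed.

Definition higher N (G : 'I_n -> U -> R) (i : 'I_n) : U -> R := fun u : U =>
  \sum_(k < N) u.1 ^+ k.+1 * ostro (m k.+1) (L k.+1) G 0 i u.

(* The modified equation is the fixed point of [picard] in the [h]-adic
   topology. *)
Definition picard N (G : 'I_n -> U -> R) (i : 'I_n) : U -> R := fun u : U =>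
  \sum_p (force p u.2 + higher N G p u) * (invmx (massmx u.2)) p i.

Lemma smooth_hX_mul k (f : U -> R) : smooth f -> smooth (fun u : U => u.1 ^+ k * f u).
Proof. by move=> sf; apply: smoothM => //; apply: smoothX; exact: smooth_h. Qed.

Lemma smooth_higher N G i : (forall i, smooth (G i)) -> smooth (higher N G i).
Proof.
by move=> sG; apply: smooth_sum => k _; apply: smooth_hX_mul; exact: smooth_ostro.
Qed.

Lemma smooth_invmass p i : smooth (fun u : U => (invmx (massmx u.2)) p i).
Proof.
apply: (@smooth_comp_snd _ _ _ (fun z => (invmx (massmx z)) p i)).
by apply: smooth_invmx => [z|a b]; [exact: regL|exact: smooth_massmx].
Qed.

Lemma smooth_picard_term N G p i : (forall i, smooth (G i)) ->
  smooth (fun u : U => (force p u.2 + higher N G p u) * (invmx (massmx u.2)) p i).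
Proof.
move=> sG; apply: smoothM; last exact: smooth_invmass.
apply: smoothD; last exact: smooth_higher.
by apply: smooth_comp_snd; exact: smooth_force.
Qed.

Lemma smooth_picard N G i : (forall i, smooth (G i)) -> smooth (picard N G i).
Proof. by move=> sG; apply: smooth_sum => p _; exact: smooth_picard_term. Qed.

Lemma eqh_hX k (f : U -> R) : smooth f -> eqh k (fun u : U => u.1 ^+ k * f u) (fun=> 0).
Proof.
move=> sf; elim: k => [//|k IH].
have -> : (fun u : U => u.1 ^+ k.+1 * f u) = fun u : U => u.1 * (u.1 ^+ k * f u).
  by apply/funext => u; rewrite exprS mulrA.
have -> : (fun=> 0) = (fun u : U => u.1 * 0) :> (U -> R) by apply/funext => u; rewrite mulr0.
by apply: (@eqh_mulh _ _ k _ (fun=> 0)) => //; [exact: smooth_hX_mul|exact: smooth_cst].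
Qed.

Lemma eqh_hX_mul j k (f g : U -> R) : smooth f -> smooth g -> eqh k f g ->
  eqh k (fun u : U => u.1 ^+ j * f u) (fun u : U => u.1 ^+ j * g u).
Proof.
move=> sf sg e; apply: eqhM => //; try by apply: smoothX; exact: smooth_h.
exact: eqh_refl.
Qed.

Lemma eqh_picard_of_higher N k G G' : (forall i, smooth (G i)) -> (forall i, smooth (G' i)) ->
  forall M, (forall i, eqh k (higher N G i) (higher M G' i)) ->
  forall i, eqh k (picard N G i) (picard M G' i).
Proof.
move=> sG sG' M eh i; apply: eqh_sum => p; try exact: smooth_picard_term.
have sf : smooth (fun u : U => force p u.2) by apply: smooth_comp_snd; exact: smooth_force.
have sh N' G0 : (forall i, smooth (G0 i)) -> smooth (fun u : U => force p u.2 + higher N' G0 p u).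
  by move=> s0; apply: smoothD => //; exact: smooth_higher.
apply: eqhM; try exact: smooth_invmass; try exact: sh; last exact: eqh_refl.
by apply: eqhD => //; try exact: smooth_higher; exact: eqh_refl.
Qed.

(** [force] and [massmx] do not involve [G], and the sum in [higher] starts at order one: a factor
    [h] splits off each term, which [eqh_mulh] turns into one more order of agreement. *)
Lemma eqh_picard N k G G' : (forall i, smooth (G i)) -> (forall i, smooth (G' i)) ->
  (forall i, eqh k (G i) (G' i)) -> forall i, eqh k.+1 (picard N G i) (picard N G' i).
Proof.
move=> sG sG' eG; apply: eqh_picard_of_higher => // p.
have so G0 j : (forall i, smooth (G0 i)) -> smooth (ostro (m j) (L j) G0 0 p).
  by move=> s0; exact: smooth_ostro.
apply: eqh_sum => [j|j|j]; try by apply: smooth_hX_mul; exact: so.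
have E G0 : (fun u : U => u.1 ^+ j.+1 * ostro (m j.+1) (L j.+1) G0 0 p u) =
    fun u : U => u.1 * (u.1 ^+ j * ostro (m j.+1) (L j.+1) G0 0 p u).
  by apply/funext => u; rewrite exprS mulrA.
rewrite !E; apply: eqh_mulh; try by apply: smooth_hX_mul; exact: so.
by apply: eqh_hX_mul; [exact: so|exact: so|exact: eqh_ostro].
Qed.

(** * Approximations, their limit and the residual of the Euler-Lagrange equations *)

Lemma eqh_recr N (f : nat -> U -> R) : (forall k, smooth (f k)) ->
  eqh N.+1 (fun u : U => \sum_(k < N.+2) u.1 ^+ k * f k u) (fun u : U => \sum_(k < N.+1) u.1 ^+ k * f k u).
Proof.
move=> sf.
have -> : (fun u : U => \sum_(k < N.+2) u.1 ^+ k * f k u) =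
    fun u : U => \sum_(k < N.+1) u.1 ^+ k * f k u + u.1 ^+ N.+1 * f N.+1 u.
  by apply/funext => u; rewrite big_ord_recr.
have -> : (fun u : U => \sum_(k < N.+1) u.1 ^+ k * f k u) =
    fun u : U => \sum_(k < N.+1) u.1 ^+ k * f k u + 0.
  by apply/funext => u; rewrite addr0.
have ss : smooth (fun u : U => \sum_(k < N.+1) u.1 ^+ k * f k u).
  by apply: smooth_sum => k _; exact: smooth_hX_mul.
apply: eqhD => //; [exact: smooth_hX_mul|exact: smooth_cst|exact: eqh_refl|].
exact: eqh_hX.
Qed.

Lemma higherS N G i u : higher N G i u =
  \sum_(k < N.+1) u.1 ^+ k * (if k == 0%N :> nat then 0 else ostro (m k) (L k) G 0 i u).
Proof. by rewrite big_ord_recl /= mulr0 add0r. Qed.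

Lemma eqh_picardS N G i : (forall i, smooth (G i)) ->
  eqh N.+1 (picard N.+1 G i) (picard N G i).
Proof.
move=> sG; apply: eqh_picard_of_higher => // p.
pose t (k : nat) (u : U) := if k == 0%N then 0 else ostro (m k) (L k) G 0 p u.
have E M : higher M G p = fun u : U => \sum_(k < M.+1) u.1 ^+ k * t k u.
  by apply/funext => u; exact: higherS.
rewrite !E; apply: (@eqh_recr N t) => -[|k]; first exact: smooth_cst.
exact: smooth_ostro.
Qed.

(** The truncation order rises with the iteration, so only finite sums occur. [higher 0] is an empty
    sum, hence [picard 0] is constant in its argument and the seed [0] is arbitrary. *)
Fixpoint approx (N : nat) : 'I_n -> U -> R :=
  if N is N'.+1 then picard N (approx N') else picard 0 (fun _ _ => 0).

Lemma smooth_approx N i : smooth (approx N i).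
Proof.
elim: N i => [|N IH] i; apply: smooth_picard => // j; exact: smooth_cst.
Qed.

(** The two claims feed each other: being fixed at order [M] makes the next approximation agree with
    this one, and applying [picard] to that agreement gains the order needed for the next one to be
    fixed. *)
Lemma approx_fixed N i : eqh N.+1 (picard N (approx N) i) (approx N i) /\
  eqh N.+1 (approx N.+1 i) (approx N i).
Proof.
have sa := smooth_approx.
suff H M : (forall i, eqh M.+1 (picard M (approx M) i) (approx M i)) ->
    forall i, eqh M.+1 (approx M.+1 i) (approx M i).
  have E : forall i, eqh N.+1 (picard N (approx N) i) (approx N i).
    elim: N {i} => [|N IH] i.
      rewrite (_ : picard 0 _ i = approx 0 i); first exact: eqh_refl.
      by apply/funext => u; rewrite /= /picard /higher;
        under eq_bigr do rewrite big_ord0; under [RHS]eq_bigr do rewrite big_ord0.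
    by apply: eqh_picard => //; exact: H.
  by split; [exact: E|exact: H].
by move=> e j; apply: eqh_trans (e j); exact: eqh_picardS.
Qed.

Definition modeq (k : nat) (z : Z) : 'rV[R]_n := \row_i hcoef k (approx k i) z.

Lemma smooth_modeq k : smooth (modeq k).
Proof. by apply: smooth_mx => _ i; apply: smooth_hcoef; exact: smooth_approx. Qed.

Definition modU N (i : 'I_n) : U -> R := fun u : U =>
  \sum_(k < N.+1) u.1 ^+ k * hcoef k (approx k i) u.2.

Lemma gtr_modeq N h z : gtr modeq N h z = \row_i modU N i (h, z).
Proof. by apply/rowP => i; rewrite summxE mxE; apply: eq_bigr => k _; rewrite !mxE. Qed.

Lemma smooth_modU N i : smooth (modU N i).
Proof.
apply: smooth_sum => k _; apply: smooth_hX; apply: smooth_hcoef; exact: smooth_approx.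
Qed.

Lemma eqh_modU N i : eqh N.+1 (modU N i) (approx N i).
Proof.
apply: (@eqh_limit _ _ N (fun k => approx k i)) => k; first exact: smooth_approx.
by have [] := approx_fixed k i.
Qed.

Definition ELU N (i : 'I_n) : U -> R := fun u : U =>
  \sum_(k < N.+1) u.1 ^+ k * ostro (m k) (L k) (modU N) 0 i u.

(** [ELU] is the residual [picard - id] at [modU N], multiplied by the mass matrix; the residual
    vanishes because [modU N] is congruent to [approx N], a fixed point to this order. *)
Lemma eqh_ELU N i : eqh N.+1 (ELU N i) (fun=> 0).
Proof.
have sM := smooth_modU N; have sa := smooth_approx N.
have sA l : smooth (fun u : U => massmx u.2 l i).
  by apply: (@smooth_comp_snd _ _ _ (fun z => massmx z l i)); exact: smooth_massmx.
have -> : ELU N i = fun u : U => \sum_l (picard N (modU N) l u - modU N l u) * massmx u.2 l i.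
  apply/funext => u; rewrite /ELU big_ord_recl expr0 mul1r ostro_L0 //.
  under [RHS]eq_bigr do rewrite mulrBl.
  rewrite sumrB addrAC; congr (_ - _).
  pose w := \row_p (force p u.2 + higher N (modU N) p u).
  have -> : \sum_l picard N (modU N) l u * massmx u.2 l i =
     (w *m invmx (massmx u.2) *m massmx u.2) 0 i.
    rewrite [RHS]mxE; apply: eq_bigr => l _; congr (_ * _); rewrite mxE.
    by apply: eq_bigr => p _; rewrite mxE.
  by rewrite mulmxKV; [rewrite mxE|exact: regL].
have -> : (fun=> 0) = (fun u : U => \sum_(l < n) 0 * massmx u.2 l i).
  by apply/funext => u; rewrite big1 // => l _; rewrite mul0r.
have sB l : smooth (fun u : U => picard N (modU N) l u - modU N l u).
  by apply: smoothB => //; exact: smooth_picard.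
apply: eqh_sum => [l|l|l]; try by apply: smoothM => //; exact: smooth_cst.
apply: eqhM => //; first exact: smooth_cst; last exact: eqh_refl.
apply: eqh_sub0 => //; first exact: smooth_picard.
apply: eqh_trans (eqh_sym (eqh_modU N l)).
apply: (@eqh_trans _ _ _ (picard N (approx N) l)); last by have [] := approx_fixed N l.
apply: (eqh_le (leqnSn N.+1)); apply: eqh_picard; [exact: sM|exact: sa|move=> j; exact: eqh_modU].
Qed.

(** For two jets agreeing up to [d], the differences of the [L k] are the coefficients of a
    polynomial in [h] of degree at most [N] with the [N + 1] roots [0, ..., N]. *)
Lemma depends_on_Ltr N d : (forall h, depends_on d (Ltr L N h)) ->
  forall k, (k <= N)%N -> depends_on d (L k).
Proof.
move=> dL k kN Y Y' YY'; pose p := \poly_(k < N.+1) (L k Y - L k Y').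
have p0 : p = 0.
  apply: (@roots_geq_poly_eq0 _ p [seq i%:R | i <- iota 0 N.+1]).
  - apply/allP => _ /mapP[i _ ->]; apply/rootP; rewrite horner_poly.
    have := dL i%:R Y Y' YY'; rewrite /Ltr => /eqP; rewrite -subr_eq0 -sumrB => /eqP e.
    by rewrite -[RHS]e; apply: eq_bigr => j _; rewrite -mulrBr mulrC.
  - rewrite map_inj_uniq ?iota_uniq // => a b /eqP; rewrite eqr_nat => /eqP //.
  - by rewrite size_map size_iota; exact: size_poly.
have := congr1 (fun q : {poly R} => q`_k) p0.
by rewrite coef_poly ltnS kN coef0 => /eqP; rewrite subr_eq0 => /eqP.
Qed.

Lemma EL_Ltr N d h z i : (forall h, depends_on d (Ltr L N h)) ->
  EL d (Ltr L N h) (fun j => prol (gtr modeq N h) j z) i = ELU N i (h, z).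
Proof.
move=> dL; have sM := smooth_modU N.
have jd (k : 'I_N.+1) : jsmooth d (L k).
  by apply: jsmooth_trans (jL k) _; apply: depends_on_Ltr dL _ _; rewrite -ltnS.
have jLtr : jsmooth d (Ltr L N h) by apply: jsmooth_lincomb.
rewrite (_ : (fun j => _) = jetf (prolU (modU N)) (h, z)); last first.
  apply/funext => j; rewrite [RHS]/jetf -prolE //; congr (prol _ _ _).
  by apply/funext => w; rewrite gtr_modeq.
rewrite (EL_ostro jLtr _ _ sM (leqnn d)) /ELU.
(* The coefficients come with bounds [m k], the truncation with [d]; both are compared at the larger
   of the two. *)
under [RHS]eq_bigr => k _.
  rewrite -(EL_ostro (jL k) _ _ sM (leq_maxr d (m k))).
  rewrite (EL_ostro (jd k) _ _ sM (leq_maxl d (m k))) /ostro big_distrr /=.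
  over.
rewrite exchange_big; apply: eq_bigr => r _ /=.
rewrite (_ : (fun u : U => pd (0 + r) i (Ltr L N h) (jetf (prolU (modU N)) u)) =
  fun u : U => \sum_(k < N.+1) h ^+ k * pd (0 + r) i (L k) (jetf (prolU (modU N)) u)); last first.
  by apply/funext => u; rewrite (@pd_lincomb _ _ d _ _ (fun k : 'I_N.+1 => h ^+ k)).
rewrite iter_flowD_lincomb //; last by move=> k; apply: (smooth_pd_flow (jL k)).
by rewrite big_distrr; apply: eq_bigr => k _ /=; rewrite mulrCA.
Qed.

End Construction.

(** * Flatness of quotients *)

Section FlatQuotient.
Context {R : realType} {V : normedModType R}.
Notation U := (R * V)%type.
Local Open Scope classical_set_scope.
Local Open Scope ring_scope.

Lemma smooth_hline (f : U -> R) z : smooth f -> smooth (fun h : R => f (h, z)).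
Proof.
move=> sf; rewrite (_ : (fun h : R => f (h, z)) =
  fun h : R => f (h *: ((1, 0) : U) + ((0, z) : U))); first exact: smooth_line.
apply/funext => h; congr f; congr pair => /=; last by rewrite scaler0 add0r.
by rewrite addr0 [RHS]mulr1.
Qed.

(** Serves to replace a function by a formula that is valid only where a denominator is nonzero. *)
Lemma near_flat_upto_eq (f g : R -> R) N :
  (\forall h \near (0 : R), f h = g h) -> flat_upto N f -> flat_upto N g.
Proof.
move=> fg ff k kN; apply: etrans (ff k kN).
suff : \forall h \near (0 : R), derive1n k g h = derive1n k f h.
  by move=> e; exact: (nbhs_singleton e).
elim: k {kN} => [|k IH]; first by apply: filterS fg => h /= e; rewrite /derive1n /= e.
move/near_join: IH; apply: filterS => h e; rewrite !derive1nS !derive1E; exact: near_eq_derive.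
Qed.

Lemma smooth_near_neq0 (q : U -> R) z : smooth q -> q (0, z) != 0 ->
  \forall h \near (0 : R), q (h, z) != 0.
Proof.
move=> sq q0; have c : {for (0 : R), continuous (fun h : R => q (h, z))}.
  apply: differentiable_continuous; apply: smooth_differentiable; exact: smooth_hline.
by apply: (c [set x | x != 0]); exact: (open_nbhs_nbhs (conj (@open_neq _ _) q0)).
Qed.

(** The quotient rule returns a quotient, with numerator [dh w * q - w * dh q] flat to one order
    less and denominator [q * q]; hence the induction over all [w] and [q]. *)
Lemma flat_quotient N (w q : U -> R) z : smooth w -> smooth q -> q (0, z) != 0 ->
  eqh N.+1 w (fun=> 0) -> flat_upto N (fun h => w (h, z) / q (h, z)).
Proof.
move=> sw sq q0; have neq := smooth_near_neq0 sq q0.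
elim: N w q sw sq q0 neq => [|N IH] w q sw sq q0 neq ew k kN.
  by move: kN ew; rewrite leqn0 => /eqP -> [w0 _]; rewrite derive1n0 w0 mul0r.
case: k kN => [_|k kN]; first by rewrite derive1n0; case: ew => -> _; rewrite mul0r.
have [sdw sdq] := (smooth_dh sw, smooth_dh sq).
pose w' u := dh w u * q u - w u * dh q u.
pose q' u := q u * q u.
have sw' : smooth w' by apply: smoothB; exact: smoothM.
have sq' : smooth q' by exact: smoothM.
rewrite derive1Sn; apply: near_flat_upto_eq k kN; last first.
  apply: (IH w' q') => //; first by rewrite mulf_neq0.
    by apply: filterS neq => h qh; rewrite mulf_neq0.
  rewrite (_ : (fun=> 0) = fun u : U => 0 * q u - 0 * dh q u); last first.
    by apply/funext => u; rewrite !mul0r subrr.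
  have s0 : smooth (fun _ : U => 0 : R) by exact: smooth_cst.
  have d0 : dh (fun _ : U => 0 : R) = fun=> 0 by apply/funext => -[h x]; rewrite dhE derive1_cst.
  have [_ edw] := ew; rewrite d0 in edw.
  apply: eqhB; try exact: smoothM.
    by apply: eqhM => //; exact: eqh_refl.
  by apply: eqhM => //; [exact: eqh_le ew|exact: eqh_refl].
apply: filterS neq => h qh; rewrite derive1E.
have sqh := smooth_hline z sq; have swh := smooth_hline z sw.
rewrite deriveM; last 2 first.
- exact: smooth_derivable.
- by apply: derivableV => //; exact: smooth_derivable.
rewrite deriveV //; last exact: smooth_derivable.
rewrite -!derive1E -!dhE /w' /q' /GRing.scale /=.
by field.
Qed.

End FlatQuotient.

(** * The Hamiltonian structure *)

Section Hamiltonian.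
Context {R : realType} {n : nat}.
Notation Z := 'rV[R]_(n + n).
Notation U := (R * Z)%type.
Variables (L : nat -> @jet R n -> R) (m : nat -> nat).
Hypothesis m0 : m 0 = 2%N.
Hypothesis jL : forall k, jsmooth (m k) (L k).
Hypothesis regL : forall Y, hess 1 (L 0%N) Y \in unitmx.

Let approx := approx L m.
Let modU := modU L m.
Let ELU := ELU L m.
Let sa N i : smooth (approx N i). Proof. exact: smooth_approx. Qed.
Let sm N i : smooth (modU N i). Proof. exact: smooth_modU. Qed.

(** * Series in [h] of a quantity attached to each Lagrangian coefficient *)

Section Expansion.
Variable T : nat -> ('I_n -> U -> R) -> U -> R.
Hypothesis sT : forall k G, (forall i, smooth (G i)) -> smooth (T k G).
Hypothesis eT : forall k j G G', (forall i, smooth (G i)) -> (forall i, smooth (G' i)) ->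
  (forall i, eqh j (G i) (G' i)) -> eqh j (T k G) (T k G').

Definition expansion N (G : 'I_n -> U -> R) : U -> R := fun u : U =>
  \sum_(k < N.+1) u.1 ^+ k * T k G u.

Definition expansion_coef (k : nat) : Z -> R := hcoef k (expansion k (approx k)).

Lemma smooth_expansion N G : (forall i, smooth (G i)) -> smooth (expansion N G).
Proof. by move=> sG; apply: smooth_sum => k _; apply: smooth_hX_mul; exact: sT. Qed.

Lemma smooth_expansion_coef k : smooth (expansion_coef k).
Proof. by apply: smooth_hcoef; exact: smooth_expansion. Qed.

Lemma eqh_expansion N j G G' : (forall i, smooth (G i)) -> (forall i, smooth (G' i)) ->
  (forall i, eqh j (G i) (G' i)) -> eqh j (expansion N G) (expansion N G').
Proof.
move=> sG sG' eG; apply: eqh_sum => [k|k|k]; try by apply: smooth_hX_mul; exact: sT.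
by apply: eqh_hX_mul; [exact: sT|exact: sT|exact: eT].
Qed.

Definition expansionU N : U -> R := fun u : U => \sum_(k < N.+1) u.1 ^+ k * expansion_coef k u.2.

Lemma smooth_expansionU N : smooth (expansionU N).
Proof. by apply: smooth_sum => k _; apply: smooth_hX; exact: smooth_expansion_coef. Qed.

(** Passing from order [k] to [k.+1] replaces the flow by a congruent one and adds a term with
    factor [h^(k+1)], so the coefficients stabilise; then [approx N] is exchanged for [modU N]. *)
Lemma eqh_expansionU N : eqh N.+1 (expansionU N) (expansion N (modU N)).
Proof.
apply: (@eqh_trans _ _ _ (expansion N (approx N))).
  apply: (@eqh_limit _ _ N (fun k => expansion k (approx k))) => k.
    exact: smooth_expansion.
  apply: (@eqh_trans _ _ _ (expansion k.+1 (approx k))).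
    apply: eqh_expansion => // i; have [_ e] := approx_fixed m0 jL regL k i; exact: e.
  by apply: (@eqh_recr _ _ k (fun k => T k (approx _))) => j; exact: sT.
apply: eqh_expansion => // i; apply: eqh_sym; exact: eqh_modU.
Qed.

End Expansion.

Lemma pz_hsum N a (f : nat -> U -> R) u : (forall k, smooth (f k)) ->
  pz a (fun u : U => \sum_(k < N.+1) u.1 ^+ k * f k u) u = \sum_(k < N.+1) u.1 ^+ k * pz a (f k) u.
Proof.
move=> sf; case: u => h z; rewrite /pz dzE /= derive_sumE => [|k]; last first.
  by apply: smoothZ; exact: smooth_section.
apply: eq_bigr => k _; rewrite deriveZE ?dzE //; exact: smooth_section.
Qed.

Definition theta_at b k (G : 'I_n -> U -> R) : U -> R := theta (m k) (L k) G b.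
Definition ham_at k (G : 'I_n -> U -> R) : U -> R := ham (m k) (L k) G.

Lemma smooth_theta_at b k G : (forall i, smooth (G i)) -> smooth (theta_at b k G).
Proof. exact: smooth_theta. Qed.

Lemma eqh_theta_at b k j G G' : (forall i, smooth (G i)) -> (forall i, smooth (G' i)) ->
  (forall i, eqh j (G i) (G' i)) -> eqh j (theta_at b k G) (theta_at b k G').
Proof. by move=> sG sG' eG; exact: eqh_theta. Qed.

Lemma smooth_ham_at k G : (forall i, smooth (G i)) -> smooth (ham_at k G).
Proof. exact: smooth_ham. Qed.

Lemma eqh_ham_at k j G G' : (forall i, smooth (G i)) -> (forall i, smooth (G' i)) ->
  (forall i, eqh j (G i) (G' i)) -> eqh j (ham_at k G) (ham_at k G').
Proof. by move=> sG sG' eG; exact: eqh_ham. Qed.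

Definition cotheta b (k : nat) : Z -> R := expansion_coef (theta_at b) k.
Definition Hmod (k : nat) : Z -> R := expansion_coef ham_at k.
(** The exterior derivative is applied to the coefficients of the one-form, so each [Jmod k] is
    exact by construction. *)
Definition Jmod (k : nat) (z : Z) : 'M[R]_(n + n) :=
  \matrix_(a, b) ('D_(delta_mx 0 a) (cotheta b k) z - 'D_(delta_mx 0 b) (cotheta a k) z).

Lemma smooth_cotheta b k : smooth (cotheta b k).
Proof. by apply: smooth_expansion_coef => k' G; exact: smooth_theta_at. Qed.

Lemma smooth_Hmod k : smooth (Hmod k).
Proof. by apply: smooth_expansion_coef => k' G; exact: smooth_ham_at. Qed.

Let thU b N := expansionU (theta_at b) N.
Let hU N := expansionU ham_at N.
Let sthU b N : smooth (thU b N). Proof. by apply: smooth_expansionU => k G; exact: smooth_theta_at. Qed.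
Let shU N : smooth (hU N). Proof. by apply: smooth_expansionU => k G; exact: smooth_ham_at. Qed.

Lemma Jtr_modE N h z a b :
  Jtr Jmod N h z a b = pz a (thU b N) (h, z) - pz b (thU a N) (h, z).
Proof.
have E a' b' : pz a' (thU b' N) (h, z) =
    \sum_(k < N.+1) h ^+ k * 'D_(delta_mx 0 a') (cotheta b' k) z.
  rewrite (@pz_hsum N a' (fun k u => cotheta b' k u.2)) => [|k].
    by apply: eq_bigr => k _; rewrite /pz dzE.
  by apply: smooth_comp_snd; exact: smooth_cotheta.
rewrite !E -sumrB /Jtr summxE.
by apply: eq_bigr => k _; rewrite !mxE mulrBr.
Qed.

Lemma grad_Htr_modE N h z a : grad (Htr Hmod N h) z 0 a = pz a (hU N) (h, z).
Proof. by rewrite mxE /pz dzE. Qed.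

(** Hamilton's equations multiplied by [J], on the modified vector field: free of the inverse
    matrix, they stay within smooth functions. *)
Definition defect N a : U -> R := fun u : U =>
  \sum_b (pz a (thU b N) u - pz b (thU a N) u) * vel (modU N) b u - pz a (hU N) u.

Lemma smooth_defect_sum (th : 'I_(n + n) -> U -> R) N a b : (forall b, smooth (th b)) ->
  smooth (fun u : U => (pz a (th b) u - pz b (th a) u) * vel (modU N) b u).
Proof.
move=> sth; apply: smoothM; last exact: smooth_vel.
by apply: smoothB; exact: smooth_pz.
Qed.

Lemma smooth_defect N a : smooth (defect N a).
Proof.
apply: smoothB; last exact: smooth_pz.
by apply: smooth_sum => b _; apply: (@smooth_defect_sum (fun b => thU b N)).
Qed.

(** The truncated series are exchanged for sums of one-forms and energies along the flow of
    [modU N], where the first variation formula is exact and leaves only a combination of the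
    [ELU N i]. *)
Lemma eqh_defect N a : eqh N.+1 (defect N a) (fun=> 0).
Proof.
pose th b := expansion (theta_at b) N (modU N); pose hm := expansion ham_at N (modU N).
have sth b : smooth (th b) by apply: smooth_expansion => // k G; exact: smooth_theta_at.
have shm : smooth hm by apply: smooth_expansion => // k G; exact: smooth_ham_at.
pose E u := \sum_b (pz a (th b) u - pz b (th a) u) * vel (modU N) b u - pz a hm u.
have eth b : eqh N.+1 (thU b N) (th b).
  apply: eqh_expansionU; [move=> k G; exact: smooth_theta_at|move=> k j G G'; exact: eqh_theta_at].
have ehm : eqh N.+1 (hU N) hm.
  apply: eqh_expansionU; [move=> k G; exact: smooth_ham_at|move=> k j G G'; exact: eqh_ham_at].
apply: (@eqh_trans _ _ _ E).
  have sthb b : smooth (thU b N) by exact: sthU.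
  apply: (@eqhB _ _ N.+1
    (fun u : U => \sum_b (pz a (thU b N) u - pz b (thU a N) u) * vel (modU N) b u) (pz a (hU N))
    (fun u : U => \sum_b (pz a (th b) u - pz b (th a) u) * vel (modU N) b u) (pz a hm)).
  - by apply: smooth_sum => b _; apply: (@smooth_defect_sum (fun b => thU b N)).
  - by apply: smooth_pz; exact: shU.
  - by apply: smooth_sum => b _; exact: smooth_defect_sum.
  - exact: smooth_pz.
  - apply: eqh_sum => [b|b|b].
    + by apply: (@smooth_defect_sum (fun b => thU b N)).
    + exact: smooth_defect_sum.
    have sv : smooth (vel (modU N) b) by exact: smooth_vel.
    apply: (@eqhM _ _ N.+1 (fun u : U => pz a (thU b N) u - pz b (thU a N) u) (vel (modU N) b)
      (fun u : U => pz a (th b) u - pz b (th a) u)); last exact: eqh_refl.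
    + by apply: smoothB; exact: smooth_pz.
    + exact: sv.
    + by apply: smoothB; exact: smooth_pz.
    + exact: sv.
    apply: (@eqhB _ _ N.+1 (pz a (thU b N)) (pz b (thU a N)) (pz a (th b)) (pz b (th a)));
      try exact: smooth_pz.
      exact: eqh_dz (sthb b) (sth b) (eth b).
    exact: eqh_dz (sthb a) (sth a) (eth a).
  - exact: eqh_dz (shU N) shm ehm.
have -> : E = fun u : U => \sum_i ELU N i u * pz a (prolU (modU N) 0 i) u.
  apply/funext => u.
  have -> : E u = \sum_(k < N.+1) u.1 ^+ k *
      (\sum_b (pz a (theta_at b k (modU N)) u - pz b (theta_at a k (modU N)) u) * vel (modU N) b u
       - pz a (ham_at k (modU N)) u).
    rewrite /E /th /hm /expansion (@pz_hsum _ _ (fun k => ham_at k (modU N))); last by move=> k; exact: smooth_ham_at.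
    under [RHS]eq_bigr do rewrite mulrBr big_distrr /=.
    rewrite sumrB exchange_big; congr (_ - _); apply: eq_bigr => b _.
    rewrite (@pz_hsum _ _ (fun k => theta_at b k (modU N))); last by move=> k; exact: smooth_theta_at.
    rewrite (@pz_hsum _ _ (fun k => theta_at a k (modU N))); last by move=> k; exact: smooth_theta_at.
    rewrite -sumrB big_distrl; apply: eq_bigr => k _ /=.
    by rewrite -mulrBr mulrA.
  under eq_bigr do rewrite /theta_at /ham_at (noether (jL _)) // addrAC subrr add0r big_distrr /=.
  rewrite exchange_big; apply: eq_bigr => i _; rewrite /ELU big_distrl /=.
  by apply: eq_bigr => k _; rewrite mulrA.
have s0 i : smooth (pz a (prolU (modU N) 0 i)) by apply: smooth_pz; exact: smooth_prolU.
have sE i : smooth (ELU N i).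
  by apply: smooth_sum => k _; apply: smooth_hX_mul; exact: smooth_ostro.
rewrite (_ : (fun=> 0) = fun u : U => \sum_(i < n) 0 * pz a (prolU (modU N) 0 i) u); last first.
  by apply/funext => u; rewrite big1 // => i _; rewrite mul0r.
apply: eqh_sum => [i|i|i]; try by apply: smoothM => //; exact: smooth_cst.
apply: eqhM => //; [exact: smooth_cst|exact: eqh_ELU|exact: eqh_refl].
Qed.

(** * Nondegeneracy at [h = 0] *)

Lemma cotheta0 b z : cotheta b 0 z =
  \sum_i pd 1 i (L 0) (jet2 z) * (b == lshift n i)%:R.
Proof.
rewrite /cotheta /expansion_coef /hcoef /= fact0 invr1 mul1r /expansion.
rewrite big_ord_recl big_ord0 expr0 mul1r addr0.
rewrite /theta_at /theta m0 !big_ord_recl big_ord0 addr0 /=.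
rewrite [X in _ + X]big1 ?addr0 => [|i _]; last by rewrite ostro_ge ?mul0r.
apply: eq_bigr => i _; rewrite pz_coordz; congr (_ * _).
rewrite /ostro big_ord_recl big_ord0 addr0 /= expr0 mul1r.
rewrite (jetf_jet2 _ _ (proj1 (jsmooth_pd _ i (jsmooth_L0 m0 jL)))) //.
Qed.

Lemma cotheta0l i z : cotheta (lshift n i) 0 z = pd 1 i (L 0) (jet2 z).
Proof.
rewrite cotheta0 (bigD1 i) //= eqxx mulr1 big1 ?addr0 // => l li.
by rewrite (inj_eq (@lshift_inj _ _)) eq_sym (negbTE li) mulr0.
Qed.

Lemma cotheta0r i z : cotheta (rshift n i) 0 z = 0.
Proof. by rewrite cotheta0 big1 // => l _; rewrite eq_rlshift mulr0. Qed.

Lemma derive_cotheta0 l i z :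
  'D_(delta_mx 0 (rshift n l)) (cotheta (lshift n i) 0) z = massmx L z l i.
Proof.
rewrite (funext (cotheta0l i)) !mxE.
pose P j p (z : Z) := if j is 0 then z 0 (lshift n p) else z 0 (rshift n p).
have sP j p : smooth (P j p) by case: j => [|j]; exact: smooth_coord.
have jP w : jetf P w = jet2 w.
  by apply/funext => j; apply/rowP => p; case: j => [|j]; rewrite !mxE.
have jp := jsmooth_pd 1 i (jsmooth_L0 m0 jL).
rewrite (_ : (fun z => _) = fun z => pd 1 i (L 0) (jetf P z)); last first.
  by apply/funext => w; rewrite jP.
have dP0 p : 'D_(delta_mx 0 (rshift n l)) (P 0%N p) z = 0.
  by rewrite /P derive_coord mxE eqxx eq_lrshift.
have dP1 p : 'D_(delta_mx 0 (rshift n l)) (P 1%N p) z = (p == l)%:R.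
  by rewrite /P derive_coord mxE eqxx (inj_eq (@rshift_inj _ _)).
rewrite (derive_jetf sP _ _ jp) big_ord_recl big_ord1 jP.
rewrite [X in X + _]big1 => [|p _]; last by rewrite dP0 mulr0.
rewrite add0r (bigD1 l isT) /= [X in _ + X]big1 => [|p pl]; last first.
  by rewrite dP1 (negbTE pl) mulr0.
by rewrite addr0 dP1 eqxx mulr1.
Qed.

Lemma derive_cotheta0r v i z : 'D_v (cotheta (rshift n i) 0) z = 0.
Proof. by rewrite (funext (cotheta0r i)); exact: derive_cst. Qed.

Lemma Jmod0_unit z : Jmod 0 z \in unitmx.
Proof.
have uA : massmx L z \in unitmx by exact: regL.
pose C := \matrix_(i, j) Jmod 0 z (lshift n i) (lshift n j).
have -> : Jmod 0 z = block_mx C (- (massmx L z)^T) (massmx L z) 0.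
  have Jab a b : Jmod 0 z a b =
      'D_(delta_mx 0 a) (cotheta b 0) z - 'D_(delta_mx 0 b) (cotheta a 0) z by rewrite mxE.
  pose sub (x y : R) := x - y.
  have Jlr i j : Jmod 0 z (lshift n i) (rshift n j) = - massmx L z j i.
    exact: etrans (Jab _ _) (etrans (congr2 sub (derive_cotheta0r _ j z)
      (derive_cotheta0 j i z)) (sub0r _)).
  have Jrl i j : Jmod 0 z (rshift n i) (lshift n j) = massmx L z i j.
    exact: etrans (Jab _ _) (etrans (congr2 sub (derive_cotheta0 i j z)
      (derive_cotheta0r _ i z)) (subr0 _)).
  have Jrr i j : Jmod 0 z (rshift n i) (rshift n j) = 0.
    exact: etrans (Jab _ _) (etrans (congr2 sub (derive_cotheta0r _ j z)
      (derive_cotheta0r _ i z)) (subr0 _)).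
  move: Jlr Jrl Jrr; rewrite /C {Jab C}; move: (Jmod 0 z) (massmx L z) => J A Jlr Jrl Jrr.
  rewrite -[LHS]submxK; congr block_mx; apply/matrixP => i j.
  - by rewrite !mxE.
  - by rewrite !mxE Jlr.
  - by rewrite !mxE Jrl.
  - by rewrite !mxE Jrr.
(* With [A] the mass matrix, a row [(v1, v2)] in the kernel satisfies [v1 A^T = 0] by the second
   block column, then [v2 A = 0] by the first, whatever [C] is. *)
rewrite -row_free_unit; apply: inj_row_free => v.
rewrite -[v]hsubmxK mul_row_block mulmx0 addr0 => /eqP; rewrite row_mx_eq0 => /andP[/eqP e1 /eqP e2].
have v1 : lsubmx v = 0.
  have uT : (massmx L z)^T \in unitmx by rewrite unitmx_tr.
  by rewrite -(mulmxK uT (lsubmx v)) -[_ *m _^T]opprK -mulmxN e2 oppr0 mul0mx.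
move: e1; rewrite v1 mul0mx add0r => e1.
by rewrite -(mulmxK uA (rsubmx v)) e1 mul0mx row_mx0.
Qed.

Lemma cyclic_cancel (x1 x2 x3 y1 y2 y3 : R) : x1 = y1 -> x2 = y2 -> x3 = y3 ->
  (x1 - x2) + (x3 - y1) + (y2 - y3) = 0.
Proof. by move=> -> -> ->; ring. Qed.

(** Closedness is [d] applied twice: six second derivatives cancel in pairs by symmetry. *)
Lemma sympl_Jmod : sympl_struct Jmod.
Proof.
have sD a b k : smooth ('D_(delta_mx 0 a) (cotheta b k)).
  by apply: smooth_derive; exact: smooth_cotheta.
split=> [k|k z|k z a b c|z]; last exact: Jmod0_unit.
- by apply: smooth_mx => a b; apply: smoothB; exact: sD.
- by apply/matrixP => a b; rewrite !mxE opprB.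
have E b' c' : (fun w => Jmod k w b' c') =
   fun w => 'D_(delta_mx 0 b') (cotheta c' k) w - 'D_(delta_mx 0 c') (cotheta b' k) w.
  by apply/funext => w; rewrite mxE.
pose D2 a' b' c' := 'D_(delta_mx 0 a') ('D_(delta_mx 0 b') (cotheta c' k)) z.
have DB a' b' c' : 'D_(delta_mx 0 a') (fun w => Jmod k w b' c') z = D2 a' b' c' - D2 a' c' b'.
  by rewrite E; apply: deriveBE; exact: sD.
have DC a' b' c' : D2 a' b' c' = D2 b' a' c'.
  by apply: derive_comm; exact: smooth_cotheta.
rewrite !DB; exact: (cyclic_cancel (DC _ _ _) (DC _ _ _) (DC _ _ _)).
Qed.

(** The two vector fields differ by [- J^-1] applied to [defect]; by Cramer's rule each component is
    a numerator congruent to zero over [det J]. *)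
Lemma flat_hamvf N z a : flat_upto N (fun h =>
  (hamvf Jmod Hmod N h z - row_mx (rsubmx z) (gtr (modeq L m) N h z)) 0 a).
Proof.
pose JU (u : U) : 'M[R]_(n + n) := \matrix_(a, b) (pz a (thU b N) u - pz b (thU a N) u).
have JE h w : Jtr Jmod N h w = JU (h, w).
  by apply/matrixP => i j; rewrite mxE Jtr_modE.
have sJ i j : smooth (fun u : U => JU u i j).
  by under eq_fun do rewrite mxE; apply: smoothB; exact: smooth_pz.
pose w u := \sum_c (-1 * (\adj (JU u)) a c) * defect N c u.
have sadj c : smooth (fun u : U => -1 * (\adj (JU u)) a c).
  by apply: smoothZ; apply: smooth_adj.
have sw : smooth w by apply: smooth_sum => c _; apply: smoothM => //; exact: smooth_defect.
have sq : smooth (fun u : U => \det (JU u)) by exact: smooth_det.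
have J0 : Jtr Jmod N 0 z = Jmod 0 z.
  rewrite /Jtr big_ord_recl expr0 scale1r big1 ?addr0 // => k _.
  by rewrite exprS mul0r scale0r.
have q0 : \det (JU (0, z)) != 0 by rewrite -JE J0 -unitfE -unitmxE Jmod0_unit.
have ew : eqh N.+1 w (fun=> 0).
  rewrite (_ : (fun=> 0) = fun u : U => \sum_c (-1 * (\adj (JU u)) a c) * 0); last first.
    by apply/funext => u; rewrite big1 // => c _; rewrite mulr0.
  have s0 : smooth (fun _ : U => 0 : R) by exact: smooth_cst.
  apply: eqh_sum => [c|c|c]; try by apply: smoothM => //; exact: smooth_defect.
  by apply: eqhM => //; [exact: smooth_defect|exact: eqh_refl|exact: eqh_defect].
apply: near_flat_upto_eq (flat_quotient sw sq q0 ew).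
(* On a singular matrix [invmx] is a default value, so the identity is claimed only near [h = 0]. *)
apply: filterS (smooth_near_neq0 sq q0) => h qh.
have uJ : JU (h, z) \in unitmx by rewrite unitmxE unitfE.
pose x := (\row_b vel (modU N) b (h, z))^T.
have xE : row_mx (rsubmx z) (gtr (modeq L m) N h z) = x^T.
  by rewrite /x trmxK velE gtr_modeq.
pose r := \col_c defect N c (h, z).
have rE : (grad (Htr Hmod N h) z)^T = JU (h, z) *m x - r.
  apply/matrixP => c j; rewrite ord1 [LHS]mxE grad_Htr_modE [RHS]mxE.
  have -> : (JU (h, z) *m x) c 0 = \sum_b (pz c (thU b N) (h, z) - pz b (thU c N) (h, z))
      * vel (modU N) b (h, z).
    by rewrite mxE; apply: eq_bigr => b _; rewrite !mxE.
  by rewrite [X in _ = _ + X]mxE [X in - X]mxE /defect opprB [RHS]addrC subrK.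
rewrite xE /hamvf JE rE mulmxBr mulKmx // linearB addrAC subrr add0r.
rewrite !mxE /w mulr_suml -sumrN; apply: eq_bigr => c _.
by rewrite !mxE /invmx uJ !mxE; ring.
Qed.

End Hamiltonian.

Theorem theorem1p1 (R : realType) (n : nat) (L : nat -> @jet R n -> R) :
  (forall k, jet_smooth (L k)) ->
  depends_on 2 (L 0%N) ->
  (forall Y : @jet R n, hess 1 (L 0%N) Y \in unitmx) ->
  exists g : nat -> 'rV[R]_(n + n) -> 'rV[R]_n,
    (forall k, smooth (g k)) /\
    (* (1) modified equation *)
    (forall (N m : nat), (forall h, depends_on m (Ltr L N h)) ->
       forall (z : 'rV[R]_(n + n)) (i : 'I_n),
         flat_upto N (fun h => EL m (Ltr L N h) (fun j => prol (gtr g N h) j z) i)) /\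
    (* (2) Hamiltonian structure *)
    exists (J : nat -> 'rV[R]_(n + n) -> 'M[R]_(n + n))
           (H : nat -> 'rV[R]_(n + n) -> R),
      sympl_struct J /\ (forall k, smooth (H k)) /\
      forall N : nat, regular_trunc L N ->
        forall (z : 'rV[R]_(n + n)) (a : 'I_(n + n)),
          flat_upto N (fun h =>
            (hamvf J H N h z - row_mx (rsubmx z) (gtr g N h z)) 0 a).
Proof.
move=> jL d2 regL.
(* The bound chosen for [L 0] is replaced by [2], since the order-zero computations unfold sums over
   exactly the entries [y] and [y']. *)
have [m [m0 jm]] : exists m : nat -> nat, m 0 = 2%N /\ forall k, jsmooth (m k) (L k).
  have [m jm] := choice jL.
  exists (fun k => if k is 0 then 2%N else m k); split=> // -[|k]; last exact: jm.
  exact: jsmooth_trans (jm 0%N) d2.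
exists (modeq L m); split; first by move=> k; exact: smooth_modeq.
split=> [N d dL z i|].
  rewrite (_ : (fun h => _) = fun h => ELU L m N i (h, z)).
    by apply: eqh_flat; exact: eqh_ELU.
  by apply/funext => h; exact: EL_Ltr.
exists (Jmod L m), (Hmod L m); split; first exact: sympl_Jmod.
split=> [k|N _ z a]; first exact: smooth_Hmod.
exact: flat_hamvf.
Qed.
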